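(* Let $x:\mathcal{D}\to\mathbb{C}$ be holomorphic on the open unit disc with $x'(z)\neq0$ for all $z\in\mathcal{D}$, and let $\Phi:\mathcal{D}\to\mathbb{CP}^1$ be the curve $\Phi(z)=[1:x(z)]$ with lifting $f=(1,x)$. Then the Schwarzian curvature $\kappa_0$ of $\Phi$ is $$\kappa_0=\frac34\left(\frac{x''}{x'}\right)^2-\frac12\,\frac{x'''}{x'}=-\frac12\,Sx,$$ where $Sx=\dfrac{x'''}{x'}-\dfrac32\left(\dfrac{x''}{x'}\right)^2$ is the Schwarzian derivative of $x$.
   Context: For a curve $\Phi:\mathcal{D}\to\mathbb{CP}^1$ with holomorphic lifting $f:\mathcal{D}\to\mathbb{C}^2\setminus\{0\}$ such that $f,f'$ are pointwise linearly independent, choose a holomorphic $\lambda:\mathcal{D}\to\mathbb{C}\setminus\{0\}$ with $\lambda^2\det[f,f']=1$ and put $\nu=\lambda f$, so that $\det[\nu,\nu']=1$. Then $\det[\nu,\nu'']=0$, so there is a unique holomorphic function $\kappa_0$ on $\mathcal{D}$ with $\nu''=\kappa_0\nu$; it is the Schwarzian curvature of $\Phi$ (it does not depend on the choice of $f$ and $\lambda$). *)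

(* Defs.v *)
From Stdlib Require Import Reals.
From Coquelicot Require Export Coquelicot.

Open Scope C_scope.

(* Maps on the disc are total functions on C; only their values on the disc matter. *)
Definition unit_disc (z : C) : Prop := (Cmod z < 1)%R.

Definition holomorphic_on (D : C -> Prop) (f : C -> C) : Prop :=
  forall z : C, D z -> @ex_derive C_AbsRing C_NormedModule f z.

Definition C2 : Type := (C * C)%type.
Definition C2_zero : C2 := (RtoC 0, RtoC 0).
Definition C2_plus (v w : C2) : C2 := (fst v + fst w, snd v + snd w).
Definition C2_scal (c : C) (v : C2) : C2 := (c * fst v, c * snd v).
Definition C2_det (v w : C2) : C := fst v * snd w - snd v * fst w.

Definition C2_lin_indep (v w : C2) : Prop :=
  forall a b : C,
    C2_plus (C2_scal a v) (C2_scal b w) = C2_zero -> a = 0 /\ b = 0.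

Definition C2_holomorphic_on (D : C -> Prop) (f : C -> C2) : Prop :=
  holomorphic_on D (fun z => fst (f z)) /\ holomorphic_on D (fun z => snd (f z)).

Definition C2_derive (f : C -> C2) (z : C) : C2 :=
  (C_derive (fun t => fst (f t)) z, C_derive (fun t => snd (f t)) z).

(* A point of the complex projective line is a one-dimensional subspace of C^2. *)
Record CP1 : Type := mkCP1 {
  line : C2 -> Prop;
  line_spec : exists v : C2, v <> C2_zero /\
    forall w : C2, line w <-> exists c : C, w = C2_scal c v
}.

(* [p = [v_1 : v_2]] *)
Definition homogeneous_coordinates (p : CP1) (v : C2) : Prop :=
  v <> C2_zero /\ forall w : C2, line p w <-> exists c : C, w = C2_scal c v.

Definition is_immersed_lifting (Phi : C -> CP1) (f : C -> C2) : Prop :=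
  C2_holomorphic_on unit_disc f /\
  forall z : C, unit_disc z ->
    homogeneous_coordinates (Phi z) (f z) /\ C2_lin_indep (f z) (C2_derive f z).

Definition is_normalizing_factor (f : C -> C2) (lambda : C -> C) : Prop :=
  holomorphic_on unit_disc lambda /\
  forall z : C, unit_disc z ->
    lambda z <> 0 /\ lambda z ^ 2 * C2_det (f z) (C2_derive f z) = 1.

(* The curvature is unique only as a function on the disc, hence a relation. *)
Definition is_schwarzian_curvature (Phi : C -> CP1) (kappa : C -> C) : Prop :=
  holomorphic_on unit_disc kappa /\
  exists (f : C -> C2) (lambda : C -> C),
    is_immersed_lifting Phi f /\
    is_normalizing_factor f lambda /\
    let nu := fun z => C2_scal (lambda z) (f z) in
    forall z : C, unit_disc z ->
      C2_derive (C2_derive nu) z = C2_scal (kappa z) (nu z).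

Definition schwarzian_derivative (x : C -> C) (z : C) : C :=
  C_derive (C_derive (C_derive x)) z / C_derive x z
  - 3 / 2 * (C_derive (C_derive x) z / C_derive x z) ^ 2.

(* Main.v *)
Require Import Defs.
From Stdlib Require Import Reals Lra.
From Coquelicot Require Import Coquelicot.
Open Scope C_scope.

(** The curve is [nu = mu * (1, x)] with [mu ^ 2 * x' = 1]: differentiating this relation gives
    [mu' = - mu x'' / (2 x')], hence [mu'' = kappa_0 mu] and [(mu x)'' = kappa_0 mu x] with the stated
    [kappa_0].  The analytic input is that derivatives of holomorphic functions are holomorphic.
    Goursat's bisection argument, applied to the contraction of a circle onto an interior point [z],
    shows that the integral of [(f w - f z) / (w - z)] over the circle vanishes; so [f] is locally a
    quotient of two Cauchy-type integrals, each of which is differentiable twice under the integral sign.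
    The normalizing factor is [c * exp (- L / 2)] for a primitive [L] of [x'' / x']. *)

(** * Complex derivatives and curves *)

(** The formula for [kappa_0] contains x''' and has itself to be holomorphic, while only one
    derivative of x is given; this is why Cauchy theory is needed. Let W be the integral of 1 / (w -
    z) over a circle and T that of f w / (w - z). W is evaluated only at the centre, where the
    integrand is constant; nearby, continuity keeps it away from 0. The vanishing integral says f W
    = T, so f' = (T' - f W') / W, and the right-hand side is differentiable because f is. The
    bisection takes place in the parameter rectangle of a homotopy and not in the plane. One
    statement then serves both the contraction of the circle and the triangles with vertex 0 behind
    the existence of primitives. The curvature is a relation over all liftings and factors. Any
    lifting is a multiple of (1, x), so every admissible curve is mu (1, x) with det = mu^2 x'. The
    same computation therefore covers all choices, and since mu has no zero, the first component of
    the equation already determines [kappa_0]. *)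

Notation is_cderive f z l := (@is_derive C_AbsRing C_NormedModule f z l).
Notation ex_cderive f z := (@ex_derive C_AbsRing C_NormedModule f z).
Notation is_curve_derive g t l := (@is_derive R_AbsRing C_R_NormedModule g t l).
Notation curve_continuous g t := (@continuous R_UniformSpace C_UniformSpace g t).
Notation curve_int g a b := (@RInt C_R_CompleteNormedModule g a b).

(** The bridge from the filter-based derivative to the explicit estimates with [Cmod] that are made
    below. *)
Lemma is_cderive_eps (f : C -> C) (z l : C) :
  is_cderive f z l <->
  forall eps : R, (0 < eps)%R -> exists d : R, (0 < d)%R /\
    forall y : C, (Cmod (y - z) < d)%R ->
      (Cmod (f y - f z - (y - z) * l) <= eps * Cmod (y - z))%R.
Proof.
split.
- intros [_ H] eps Heps.
  destruct (H z (fun P HP => HP) (mkposreal eps Heps)) as [d Hd].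
  exists d; split; [apply cond_pos|].
  intros y Hy; exact (Hd y Hy).
- intros H; split; [apply is_linear_scal_l|].
  intros y Hy.
  generalize (@is_filter_lim_locally_unique C_AbsRing (AbsRing_NormedModule C_AbsRing) z y Hy).
  intros <-; clear Hy.
  intros eps. destruct (H eps (cond_pos eps)) as [d [Hd Hf]].
  exists (mkposreal d Hd); intros y Hy; exact (Hf y Hy).
Qed.

Lemma norm_C_R (z : C) : @norm _ C_R_NormedModule z = Cmod z.
Proof.
unfold norm; simpl; unfold prod_norm, Cmod, norm; simpl; unfold abs; simpl.
now rewrite !Rmult_1_r, <- !Rabs_mult, !(Rabs_pos_eq (_ * _)) by (apply Rle_0_sqr).
Qed.

Lemma is_curve_derive_eps (g : R -> C) (t : R) (l : C) :
  is_curve_derive g t l <->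
  forall eps : R, (0 < eps)%R -> exists d : R, (0 < d)%R /\
    forall s : R, (Rabs (s - t) < d)%R ->
      (Cmod (g s - g t - RtoC (s - t) * l) <= eps * Rabs (s - t))%R.
Proof.
split.
- intros [_ H] eps Heps.
  destruct (H t (fun P HP => HP) (mkposreal eps Heps)) as [d Hd].
  exists d; split; [apply cond_pos|].
  intros y Hy. generalize (Hd y Hy).
  rewrite norm_C_R, <- scal_R_Cmult. exact (fun H => H).
- intros H; split; [apply is_linear_scal_l|].
  intros y Hy.
  generalize (@is_filter_lim_locally_unique R_AbsRing (AbsRing_NormedModule R_AbsRing) t y Hy).
  intros <-; clear Hy.
  intros eps. destruct (H eps (cond_pos eps)) as [d [Hd Hf]].
  exists (mkposreal d Hd); intros y Hy.
  generalize (Hf y Hy).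
  rewrite norm_C_R, <- scal_R_Cmult. exact (fun H => H).
Qed.

Lemma curve_continuous_eps (g : R -> C) (t : R) :
  curve_continuous g t <->
  forall eps : R, (0 < eps)%R -> exists d : R, (0 < d)%R /\
    forall s : R, (Rabs (s - t) < d)%R -> (Cmod (g s - g t) < eps)%R.
Proof.
split.
- intros H eps Heps.
  assert (H2 : locally (T := C_UniformSpace) (g t) (fun w => (Cmod (w - g t) < eps)%R)).
  { apply locally_C. exists (mkposreal eps Heps). intros y Hy; exact Hy. }
  destruct (H _ H2) as [d Hd].
  exists d; split; [apply cond_pos|]. intros s Hs; exact (Hd s Hs).
- intros H P HP. apply locally_C in HP. destruct HP as [e He].
  destruct (H e (cond_pos e)) as [d [Hd Hs]].
  exists (mkposreal d Hd). intros s Hs'. apply He. exact (Hs s Hs').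
Qed.

Lemma is_cderive_continuous (f : C -> C) (z : C) :
  ex_cderive f z ->
  forall eps : R, (0 < eps)%R -> exists d : R, (0 < d)%R /\
    forall y : C, (Cmod (y - z) < d)%R -> (Cmod (f y - f z) < eps)%R.
Proof.
intros [l H] eps Heps.
destruct (proj1 (is_cderive_eps f z l) H 1%R Rlt_0_1) as [d [Hd Hf]].
assert (Hl := Cmod_ge_0 l).
exists (Rmin d (eps / (2 + Cmod l))).
(* With error constant 1 the increment of [f] is at most (1 + |l|) |y - z|; 2 + |l| leaves a margin
   for the strict inequality. *)
assert (He : (0 < eps / (2 + Cmod l))%R) by (apply Rdiv_lt_0_compat; lra).
split; [now apply Rmin_pos|].
intros y Hy.
assert (Hy1 := Rlt_le_trans _ _ _ Hy (Rmin_l _ _)).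
assert (Hy2 := Rlt_le_trans _ _ _ Hy (Rmin_r _ _)).
specialize (Hf y Hy1).
replace (f y - f z) with ((f y - f z - (y - z) * l) + (y - z) * l) by ring.
eapply Rle_lt_trans; [apply Cmod_triangle|]. rewrite Cmod_mult.
assert (E : (eps / (2 + Cmod l) * (2 + Cmod l) = eps)%R) by (field; lra).
assert (Hyz := Cmod_ge_0 (y - z)).
assert (Cmod (y - z) * (2 + Cmod l) < eps)%R.
{ rewrite <- E. apply Rmult_lt_compat_r; lra. }
nra.
Qed.

(* The chain rule mixes the scalar fields C and R, so [is_derive_comp] does not apply. *)
Lemma is_curve_derive_comp (f : C -> C) (g : R -> C) (t : R) (l m : C) :
  is_cderive f (g t) l -> is_curve_derive g t m ->
  is_curve_derive (fun s => f (g s)) t (l * m).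
Proof.
intros Hf Hg. apply is_curve_derive_eps. intros eps Heps.
assert (Hm := Cmod_ge_0 m). assert (Hl := Cmod_ge_0 l).
(* The error of [f] is measured against the increment of [g], which is at most (1 + |m|) |s - t|
   because [e2] is at most 1. The other bound on [e2] pays for the error of [g] multiplied by |l|.
   Each part costs eps / 2. *)
set (e1 := (eps / (2 * (1 + Cmod m)))%R).
assert (He1 : (0 < e1)%R) by (apply Rdiv_lt_0_compat; lra).
set (e2 := Rmin 1 (eps / (2 * (1 + Cmod l)))%R).
assert (He2 : (0 < e2)%R) by (apply Rmin_pos; [lra|apply Rdiv_lt_0_compat; lra]).
destruct (proj1 (is_cderive_eps _ _ _) Hf e1 He1) as [d1 [Hd1 H1]].
destruct (proj1 (is_curve_derive_eps _ _ _) Hg e2 He2) as [d2 [Hd2 H2]].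
assert (Hd3 : (0 < d1 / (1 + Cmod m))%R) by (apply Rdiv_lt_0_compat; lra).
exists (Rmin d2 (d1 / (1 + Cmod m))). split; [now apply Rmin_pos|].
intros s Hs.
assert (Hs1 := Rlt_le_trans _ _ _ Hs (Rmin_l _ _)).
assert (Hs2 := Rlt_le_trans _ _ _ Hs (Rmin_r _ _)).
specialize (H2 s Hs1).
assert (Hst := Rabs_pos (s - t)).
assert (e21 : (e2 <= 1)%R) by apply Rmin_l.
assert (e22 : (e2 <= eps / (2 * (1 + Cmod l)))%R) by apply Rmin_r.
assert (B : (Cmod (g s - g t) <= (1 + Cmod m) * Rabs (s - t))%R).
{ replace (g s - g t) with ((g s - g t - RtoC (s - t) * m) + RtoC (s - t) * m) by ring.
  eapply Rle_trans; [apply Cmod_triangle|]. rewrite Cmod_mult, Cmod_R. nra. }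
assert (B2 : (Cmod (g s - g t) < d1)%R).
{ eapply Rle_lt_trans; [apply B|].
  apply Rmult_lt_compat_l with (r := (1 + Cmod m)%R) in Hs2; [|lra].
  replace ((1 + Cmod m) * (d1 / (1 + Cmod m)))%R with d1 in Hs2 by (field; lra). exact Hs2. }
specialize (H1 _ B2).
replace (f (g s) - f (g t) - RtoC (s - t) * (l * m)) with
  ((f (g s) - f (g t) - (g s - g t) * l) + l * (g s - g t - RtoC (s - t) * m)) by ring.
eapply Rle_trans; [apply Cmod_triangle|]. rewrite Cmod_mult.
assert (E1 : (e1 * ((1 + Cmod m) * Rabs (s - t)) = eps / 2 * Rabs (s - t))%R)
  by (unfold e1; field; lra).
assert (E2 : (e1 * Cmod (g s - g t) <= eps / 2 * Rabs (s - t))%R)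
  by (rewrite <- E1; apply Rmult_le_compat_l; lra).
assert (E3 : (Cmod l * (e2 * Rabs (s - t)) <= eps / 2 * Rabs (s - t))%R).
{ rewrite <- Rmult_assoc. apply Rmult_le_compat_r; [assumption|].
  apply Rle_trans with ((1 + Cmod l) * (eps / (2 * (1 + Cmod l))))%R.
  - apply Rmult_le_compat; lra.
  - right; field; lra. }
assert (Cmod l * Cmod (g s - g t - RtoC (s - t) * m) <= Cmod l * (e2 * Rabs (s - t)))%R
  by (apply Rmult_le_compat_l; assumption).
lra.
Qed.

Lemma curve_continuous_comp (f : C -> C) (g : R -> C) (t : R) :
  ex_cderive f (g t) -> curve_continuous g t -> curve_continuous (fun s => f (g s)) t.
Proof.
intros Hf Hg. apply curve_continuous_eps. intros eps Heps.
destruct (is_cderive_continuous _ _ Hf eps Heps) as [d [Hd H]].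
destruct (proj1 (curve_continuous_eps _ _) Hg d Hd) as [d' [Hd' H']].
exists d'; split; [assumption|]. intros s Hs. apply H, H', Hs.
Qed.

Lemma curve_continuous_mult (g h : R -> C) (t : R) :
  curve_continuous g t -> curve_continuous h t -> curve_continuous (fun s => g s * h s) t.
Proof.
intros Hg Hh. apply curve_continuous_eps. intros eps Heps.
assert (G := Cmod_ge_0 (g t)). assert (H := Cmod_ge_0 (h t)).
set (e1 := Rmin 1 (eps / (2 * (1 + Cmod (h t))))%R).
assert (He1 : (0 < e1)%R) by (apply Rmin_pos; [lra|apply Rdiv_lt_0_compat; lra]).
set (e2 := (eps / (2 * (1 + Cmod (g t))))%R).
assert (He2 : (0 < e2)%R) by (apply Rdiv_lt_0_compat; lra).
destruct (proj1 (curve_continuous_eps _ _) Hg e1 He1) as [d1 [Hd1 H1]].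
destruct (proj1 (curve_continuous_eps _ _) Hh e2 He2) as [d2 [Hd2 H2]].
exists (Rmin d1 d2); split; [now apply Rmin_pos|]. intros s Hs.
specialize (H1 s (Rlt_le_trans _ _ _ Hs (Rmin_l _ _))).
specialize (H2 s (Rlt_le_trans _ _ _ Hs (Rmin_r _ _))).
assert (e11 : (e1 <= 1)%R) by apply Rmin_l.
assert (e12 : (e1 <= eps / (2 * (1 + Cmod (h t))))%R) by apply Rmin_r.
replace (g s * h s - g t * h t) with
  ((g s - g t) * (h s - h t) + g t * (h s - h t) + (g s - g t) * h t) by ring.
eapply Rle_lt_trans; [apply Cmod_triangle|].
eapply Rle_lt_trans; [apply Rplus_le_compat_r, Cmod_triangle|].
rewrite !Cmod_mult.
assert (P1 := Cmod_ge_0 (g s - g t)). assert (P2 := Cmod_ge_0 (h s - h t)).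
assert (E1 : (e2 * (1 + Cmod (g t)) = eps / 2)%R) by (unfold e2; field; lra).
assert (E2 : (e1 * Cmod (h t) < eps / 2)%R).
{ apply Rle_lt_trans with (eps / (2 * (1 + Cmod (h t))) * Cmod (h t))%R.
  - apply Rmult_le_compat_r; lra.
  - apply Rlt_le_trans with (eps / (2 * (1 + Cmod (h t))) * (1 + Cmod (h t)))%R.
    + apply Rmult_lt_compat_l; [apply Rdiv_lt_0_compat; lra|lra].
    + right; field; lra. }
assert ((Cmod (g s - g t) * Cmod (h s - h t) + Cmod (g t) * Cmod (h s - h t) <= e2 * (1 + Cmod (g t)))%R).
{ rewrite <- Rmult_plus_distr_r, Rmult_comm. apply Rmult_le_compat; lra. }
assert (Cmod (g s - g t) * Cmod (h t) <= e1 * Cmod (h t))%R by (apply Rmult_le_compat_r; lra).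
lra.
Qed.

Lemma is_curve_derive_continuous (g : R -> C) (t : R) (l : C) :
  is_curve_derive g t l -> curve_continuous g t.
Proof.
intros H. apply (@ex_derive_continuous R_AbsRing C_R_NormedModule). now exists l.
Qed.

Lemma is_cderive_const (c z : C) : is_cderive (fun _ => c) z (RtoC 0).
Proof. exact (@is_derive_const C_AbsRing C_NormedModule c z). Qed.

Lemma is_cderive_id (z : C) : is_cderive (fun y => y) z (RtoC 1).
Proof.
apply is_cderive_eps; intros eps He; exists 1%R; split; [lra|]; intros y _.
replace (y - z - (y - z) * 1) with (RtoC 0) by ring. rewrite Cmod_0.
apply Rmult_le_pos; [lra|apply Cmod_ge_0].
Qed.

Lemma is_cderive_plus (f g : C -> C) (z l m : C) :
  is_cderive f z l -> is_cderive g z m -> is_cderive (fun y => f y + g y) z (l + m).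
Proof. exact (@is_derive_plus C_AbsRing C_NormedModule f g z l m). Qed.

Lemma is_cderive_minus (f g : C -> C) (z l m : C) :
  is_cderive f z l -> is_cderive g z m -> is_cderive (fun y => f y - g y) z (l - m).
Proof. exact (@is_derive_minus C_AbsRing C_NormedModule f g z l m). Qed.

Lemma is_cderive_ext_loc (f g : C -> C) (z l : C) (d : R) :
  (0 < d)%R -> (forall y, (Cmod (y - z) < d)%R -> f y = g y) ->
  is_cderive f z l -> is_cderive g z l.
Proof.
intros Hd H. apply is_derive_ext_loc. exists (mkposreal d Hd). intros y Hy; apply H, Hy.
Qed.

Lemma is_cderive_mult (f g : C -> C) (z l m : C) :
  is_cderive f z l -> is_cderive g z m ->
  is_cderive (fun y => f y * g y) z (l * g z + f z * m).
Proof.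
intros Hf Hg.
generalize (fun Hf Hg => @is_derive_mult C_AbsRing f g z l m Hf Hg Cmult_comm).
intros K.
(* The product rule is available for the ring as a module over itself. The remainder estimates of
   the two structures are convertible; only the linearity component is rebuilt. *)
assert (T : forall h k, is_cderive h z k <-> @is_derive C_AbsRing (AbsRing_NormedModule C_AbsRing) h z k).
{ intros h k; split; intros [_ D]; (split; [apply is_linear_scal_l|exact D]). }
apply T, K; now apply T.
Qed.

Lemma is_cderive_comp (f g : C -> C) (z l m : C) :
  is_cderive f (g z) l -> is_cderive g z m -> is_cderive (fun y => f (g y)) z (m * l).
Proof.
intros Hf Hg.
apply (@is_derive_comp C_AbsRing C_NormedModule f g z l m Hf).
destruct Hg as [_ D]; split; [apply is_linear_scal_l|exact D].
Qed.

(** * Bisection of rectangles *)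

(** The point is the supremum of the left endpoints, for which every right endpoint is an upper
    bound. *)
Lemma nested_intervals_point (u v : nat -> R) :
  (forall n, (u n <= u (S n))%R) -> (forall n, (v (S n) <= v n)%R) ->
  (forall n, (u n <= v n)%R) ->
  exists x : R, forall n, (u n <= x <= v n)%R.
Proof.
intros Hu Hv Huv.
assert (Iu : forall n k, (u n <= u (n + k)%nat)%R).
{ intros n k; induction k; [rewrite Nat.add_0_r; lra|].
  rewrite Nat.add_succ_r. specialize (Hu (n + k)%nat). lra. }
assert (Iv : forall n k, (v (n + k)%nat <= v n)%R).
{ intros n k; induction k; [rewrite Nat.add_0_r; lra|].
  rewrite Nat.add_succ_r. specialize (Hv (n + k)%nat). lra. }
assert (Iuv : forall n m, (u n <= v m)%R).
{ intros n m. apply Rle_trans with (u (n + m)%nat); [apply Iu|].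
  apply Rle_trans with (v (n + m)%nat); [apply Huv|].
  rewrite Nat.add_comm; apply Iv. }
destruct (completeness (fun y => exists n, y = u n)) as [x [Hx1 Hx2]].
- exists (v 0%nat). intros y [n ->]. apply Iuv.
- exists (u 0%nat). now exists 0%nat.
- exists x; intros n; split; [apply Hx1; now exists n|].
  apply Hx2. intros y [k ->]; apply Iuv.
Qed.

Section Bisection.

Variable I : R -> R -> R -> R -> C.

Definition rect : Type := (R * R * (R * R))%type.
Definition rect_val (r : rect) : C :=
  I (fst (fst r)) (snd (fst r)) (fst (snd r)) (snd (snd r)).
Definition rect_in (r q : rect) : Prop :=
  (fst (fst q) <= fst (fst r) /\ fst (fst r) <= snd (fst r) /\ snd (fst r) <= snd (fst q) /\
   fst (snd q) <= fst (snd r) /\ fst (snd r) <= snd (snd r) /\ snd (snd r) <= snd (snd q))%R.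

(** A quarter is heavy if it carries at least a quarter of the modulus of [r]. The last one is the
    default and is not tested. *)
Definition heavy_quarter (r : rect) : rect :=
  let '((s0, s2), (t0, t2)) := r in
  let s1 := ((s0 + s2) / 2)%R in
  let t1 := ((t0 + t2) / 2)%R in
  let heavy q := Rle_dec (Cmod (rect_val r)) (4 * Cmod (rect_val q)) in
  if heavy ((s0, s1), (t0, t1)) then ((s0, s1), (t0, t1))
  else if heavy ((s0, s1), (t1, t2)) then ((s0, s1), (t1, t2))
  else if heavy ((s1, s2), (t0, t1)) then ((s1, s2), (t0, t1))
  else ((s1, s2), (t1, t2)).

Variables a b c d : R.
Hypothesis I_split_s : forall s0 s1 s2 t0 t1 : R,
  (a <= s0 <= s1)%R -> (s1 <= s2 <= b)%R -> (c <= t0 <= t1)%R -> (t1 <= d)%R ->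
  I s0 s2 t0 t1 = I s0 s1 t0 t1 + I s1 s2 t0 t1.
Hypothesis I_split_t : forall s0 s1 t0 t1 t2 : R,
  (a <= s0 <= s1)%R -> (s1 <= b)%R -> (c <= t0 <= t1)%R -> (t1 <= t2 <= d)%R ->
  I s0 s1 t0 t2 = I s0 s1 t0 t1 + I s0 s1 t1 t2.

Lemma heavy_quarter_spec (r : rect) :
  rect_in r ((a, b), (c, d)) ->
  rect_in (heavy_quarter r) r /\
  (Cmod (rect_val r) <= 4 * Cmod (rect_val (heavy_quarter r)))%R /\
  (snd (fst (heavy_quarter r)) - fst (fst (heavy_quarter r)) = (snd (fst r) - fst (fst r)) / 2)%R /\
  (snd (snd (heavy_quarter r)) - fst (snd (heavy_quarter r)) = (snd (snd r) - fst (snd r)) / 2)%R.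
Proof.
destruct r as [[s0 s2] [t0 t2]]; unfold rect_in; simpl; intros H.
destruct (Rle_dec _ _) as [H1|H1]; [simpl; repeat split; lra|].
destruct (Rle_dec _ _) as [H2|H2]; [simpl; repeat split; lra|].
destruct (Rle_dec _ _) as [H3|H3]; [simpl; repeat split; lra|].
simpl; repeat split; try lra.
apply Rnot_le_lt in H1, H2, H3. unfold rect_val in *; simpl in *.
set (s1 := ((s0 + s2) / 2)%R) in *. set (t1 := ((t0 + t2) / 2)%R) in *.
assert (Hs1 : (s0 <= s1 <= s2)%R) by (unfold s1; lra).
assert (Ht1 : (t0 <= t1 <= t2)%R) by (unfold t1; lra).
clearbody s1 t1.
(* The four quarters add up to the whole. As the first three are light, the triangle inequality
   leaves at least a quarter of the modulus to the last. *)
assert (E : I s0 s2 t0 t2 = I s0 s1 t0 t1 + I s0 s1 t1 t2 + (I s1 s2 t0 t1 + I s1 s2 t1 t2)).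
{ rewrite (I_split_s s0 s1 s2) by lra. now rewrite !(I_split_t _ _ t0 t1 t2) by lra. }
assert (T := Cmod_triangle (I s0 s1 t0 t1 + I s0 s1 t1 t2) (I s1 s2 t0 t1 + I s1 s2 t1 t2)).
rewrite <- E in T.
assert (T1 := Cmod_triangle (I s0 s1 t0 t1) (I s0 s1 t1 t2)).
assert (T2 := Cmod_triangle (I s1 s2 t0 t1) (I s1 s2 t1 t2)).
lra.
Qed.

Lemma rect_in_trans (p q r : rect) : rect_in p q -> rect_in q r -> rect_in p r.
Proof. unfold rect_in; intros; repeat split; lra. Qed.

(** A nonzero value of modulus m would leave at least m / 4^n on the n-th heavy rectangle. Its sides
    shrink like 1 / 2^n, so near the common point of the rectangles the local hypothesis allows only
    a small multiple of 1 / 4^n. *)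
Lemma additive_rectangle_function_zero :
  (a <= b)%R -> (c <= d)%R ->
  (forall x y : R, (a <= x <= b)%R -> (c <= y <= d)%R ->
   forall eps : R, (0 < eps)%R -> exists delta : R, (0 < delta)%R /\
   forall s0 s1 t0 t1 : R,
     (a <= s0 <= x)%R -> (x <= s1 <= b)%R -> (c <= t0 <= y)%R -> (y <= t1 <= d)%R ->
     (s1 - s0 < delta)%R -> (t1 - t0 < delta)%R ->
     (Cmod (I s0 s1 t0 t1) <= eps * ((s1 - s0) + (t1 - t0)) ^ 2)%R) ->
  I a b c d = 0.
Proof.
intros Hab Hcd Hloc.
destruct (Ceq_dec (I a b c d) 0) as [|Hne]; [assumption|exfalso].
apply Cmod_gt_0 in Hne. set (m := Cmod (I a b c d)) in *.
set (r := fun n => Nat.iter n heavy_quarter ((a, b), (c, d))).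
assert (Hr : forall n, rect_in (r n) ((a, b), (c, d))).
{ induction n; [unfold rect_in; simpl; lra|].
  apply rect_in_trans with (r n); [|assumption]. now apply (heavy_quarter_spec (r n)). }
assert (HrS : forall n, rect_in (r (S n)) (r n)).
{ intros n. now apply (heavy_quarter_spec (r n)). }
assert (Hlen : forall n, (snd (fst (r n)) - fst (fst (r n)) = (b - a) / 2 ^ n /\
                          snd (snd (r n)) - fst (snd (r n)) = (d - c) / 2 ^ n)%R).
{ induction n as [|n IH]; [simpl; lra|].
  destruct (heavy_quarter_spec (r n) (Hr n)) as (_ & _ & E1 & E2).
  change (heavy_quarter (r n)) with (r (S n)) in E1, E2. rewrite E1, E2.
  destruct IH as [-> ->]. assert (2 ^ n <> 0)%R by (apply pow_nonzero; lra).
  simpl; split; field; assumption. }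
assert (Hval : forall n, (m <= 4 ^ n * Cmod (rect_val (r n)))%R).
{ induction n as [|n IH]; [unfold rect_val; simpl; unfold m; lra|].
  destruct (heavy_quarter_spec (r n) (Hr n)) as (_ & E & _).
  change (heavy_quarter (r n)) with (r (S n)) in E.
  eapply Rle_trans; [apply IH|]. simpl pow.
  assert (0 < 4 ^ n)%R by (apply pow_lt; lra). nra. }
destruct (nested_intervals_point (fun n => fst (fst (r n))) (fun n => snd (fst (r n))))
  as [x Hx]; [intros n; apply (HrS n)..|intros n; apply (Hr n)|].
destruct (nested_intervals_point (fun n => fst (snd (r n))) (fun n => snd (snd (r n))))
  as [y Hy]; [intros n; apply (HrS n)..|intros n; apply (Hr n)|].
set (L := ((b - a) + (d - c))%R).
assert (HL : (0 <= L)%R) by (unfold L; lra).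
(* With this tolerance the local bound, multiplied by 4^n, becomes m L^2 / (1 + L^2), which is
   strictly below m even for L = 0. *)
assert (Heps : (0 < m / (1 + L ^ 2))%R) by (apply Rdiv_lt_0_compat; [assumption|nra]).
destruct (Hloc x y (Hx 0%nat) (Hy 0%nat) _ Heps) as [delta [Hd Hsmall]].
assert (Hn : exists n, (L / 2 ^ n < delta)%R).
{ destruct (pow_lt_1_zero (/ 2)) with (y := (delta / (1 + L))%R) as [n Hn].
  - rewrite Rabs_pos_eq; lra.
  - apply Rdiv_lt_0_compat; lra.
  - exists n. specialize (Hn n (Nat.le_refl n)).
    rewrite Rabs_pos_eq, pow_inv in Hn by (apply pow_le; lra).
    assert (P : (0 < 2 ^ n)%R) by (apply pow_lt; lra).
    assert (Q : (0 < / 2 ^ n)%R) by now apply Rinv_0_lt_compat.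
    apply Rle_lt_trans with ((1 + L) * / 2 ^ n)%R; [unfold Rdiv; nra|].
    apply Rmult_lt_compat_l with (r := (1 + L)%R) in Hn; [|lra].
    replace ((1 + L) * (delta / (1 + L)))%R with delta in Hn by (field; lra). exact Hn. }
destruct Hn as [n Hn].
destruct (Hlen n) as [E1 E2]. specialize (Hval n).
assert (P : (0 < 2 ^ n)%R) by (apply pow_lt; lra).
assert (E3 : (L / 2 ^ n = (b - a) / 2 ^ n + (d - c) / 2 ^ n)%R) by (unfold L; field; lra).
assert (Q1 : (0 <= (b - a) / 2 ^ n)%R) by (apply Rmult_le_pos; [lra|now left; apply Rinv_0_lt_compat]).
assert (Q2 : (0 <= (d - c) / 2 ^ n)%R) by (apply Rmult_le_pos; [lra|now left; apply Rinv_0_lt_compat]).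
assert (S := Hsmall (fst (fst (r n))) (snd (fst (r n))) (fst (snd (r n))) (snd (snd (r n)))).
specialize (Hr n). unfold rect_in in Hr; simpl in Hr.
specialize (Hx n); specialize (Hy n); simpl in Hx, Hy.
specialize (S ltac:(lra) ltac:(lra) ltac:(lra) ltac:(lra) ltac:(lra) ltac:(lra)).
fold (rect_val (r n)) in S. rewrite E1, E2, <- E3 in S.
apply Rmult_le_compat_l with (r := (4 ^ n)%R) in S; [|apply pow_le; lra].
assert (E4 : (4 ^ n = 2 ^ n * 2 ^ n)%R) by (rewrite <- Rpow_mult_distr; f_equal; lra).
assert (E5 : (4 ^ n * (m / (1 + L ^ 2) * (L / 2 ^ n) ^ 2) = m * L ^ 2 / (1 + L ^ 2))%R)
  by (rewrite E4; field; split; nra).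
rewrite E5 in S.
assert (m * L ^ 2 / (1 + L ^ 2) < m)%R.
{ apply Rmult_lt_reg_r with (1 + L ^ 2)%R; [nra|].
  replace (m * L ^ 2 / (1 + L ^ 2) * (1 + L ^ 2))%R with (m * L ^ 2)%R by (field; nra). nra. }
lra.
Qed.

End Bisection.

(** * Path integrals and Goursat's theorem *)

(** The velocity [dg] is a separate argument; that it is the derivative of [g] is a hypothesis of
    the lemmas that rely on it. *)
Definition path_int (F : C -> C) (g dg : R -> C) (a b : R) : C :=
  curve_int (fun t => F (g t) * dg t) a b.

Lemma is_path_int (F : C -> C) (g dg : R -> C) (a b : R) :
  (a <= b)%R ->
  (forall t, (a <= t <= b)%R -> ex_cderive F (g t) /\ curve_continuous g t /\ curve_continuous dg t) ->
  @is_RInt C_R_CompleteNormedModule (fun t => F (g t) * dg t) a b (path_int F g dg a b).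
Proof.
intros Hab H. apply RInt_correct, ex_RInt_continuous.
intros t Ht. rewrite Rmin_left, Rmax_right in Ht by assumption.
destruct (H t Ht) as (H1 & H2 & H3).
apply curve_continuous_mult; [now apply curve_continuous_comp|assumption].
Qed.

Lemma path_int_chasles (F : C -> C) (g dg : R -> C) (a b c : R) :
  (a <= b <= c)%R ->
  (forall t, (a <= t <= c)%R -> ex_cderive F (g t) /\ curve_continuous g t /\ curve_continuous dg t) ->
  path_int F g dg a c = path_int F g dg a b + path_int F g dg b c.
Proof.
intros Habc H. symmetry.
apply (@RInt_Chasles C_R_CompleteNormedModule).
- eexists; apply is_path_int; [lra|]; intros; apply H; lra.
- eexists; apply is_path_int; [lra|]; intros; apply H; lra.
Qed.

(** The part [A] of the integrand integrates exactly to the increment of its primitive [G]; the rest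
    is bounded by length times supremum. [A] will be affine in Goursat's argument, zero on small
    circles and constant for primitives. *)
Lemma path_int_near_primitive (F A G : C -> C) (g dg : R -> C) (a b eps K : R) :
  (a <= b)%R ->
  (forall t, (a <= t <= b)%R -> ex_cderive F (g t) /\ is_curve_derive g t (dg t) /\ curve_continuous dg t) ->
  (forall t, (a <= t <= b)%R -> is_cderive G (g t) (A (g t)) /\ ex_cderive A (g t)) ->
  (forall t, (a <= t <= b)%R -> (Cmod (F (g t) - A (g t)) <= eps)%R /\ (Cmod (dg t) <= K)%R) ->
  (Cmod (path_int F g dg a b - (G (g b) - G (g a))) <= (b - a) * (eps * K))%R.
Proof.
intros Hab HF HG HK.
assert (I1 := is_path_int F g dg a b Hab).
assert (I2 : @is_RInt C_R_CompleteNormedModule (fun t => A (g t) * dg t) a b (G (g b) - G (g a))).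
{ apply (@is_RInt_derive C_R_CompleteNormedModule (fun t => G (g t)));
  intros t Ht; rewrite Rmin_left, Rmax_right in Ht by assumption;
  destruct (HF t Ht) as (? & ? & ?); destruct (HG t Ht) as (? & ?).
  - now apply is_curve_derive_comp.
  - apply curve_continuous_mult; [apply curve_continuous_comp|]; try assumption.
    now apply is_curve_derive_continuous with (dg t). }
rewrite <- norm_C_R.
apply (@norm_RInt_le_const C_R_NormedModule
  (fun t => F (g t) * dg t - A (g t) * dg t)); [assumption| |].
- intros t Ht. rewrite norm_C_R.
  replace (F (g t) * dg t - A (g t) * dg t) with ((F (g t) - A (g t)) * dg t) by ring.
  rewrite Cmod_mult. destruct (HK t Ht).
  apply Rmult_le_compat; try apply Cmod_ge_0; assumption.
- apply (@is_RInt_minus C_R_NormedModule); [apply I1|exact I2].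
  intros t Ht; destruct (HF t Ht) as (? & ? & ?); repeat split; try assumption.
  now apply is_curve_derive_continuous with (dg t).
Qed.

(** A quadratic primitive of the first-order Taylor polynomial at [z0] with value [f0] and slope
    [l]. *)
Lemma is_cderive_affine_primitive (z f0 l z0 : C) :
  is_cderive (fun y => f0 * y + l / 2 * ((y - z0) * (y - z0))) z (f0 + (z - z0) * l).
Proof.
assert (H1 : is_cderive (fun y => y - z0) z (1 - 0)).
{ apply is_cderive_minus; [apply is_cderive_id|apply is_cderive_const]. }
assert (H := is_cderive_plus _ _ _ _ _
  (is_cderive_mult _ _ _ _ _ (is_cderive_const f0 z) (is_cderive_id z))
  (is_cderive_mult _ _ _ _ _ (is_cderive_const (l / 2) z) (is_cderive_mult _ _ _ _ _ H1 H1))).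
simpl in H.
match type of H with is_derive _ _ ?v => replace (f0 + (z - z0) * l) with v; [exact H|] end.
field.
Qed.

Lemma ex_cderive_affine (z f0 l z0 : C) : ex_cderive (fun y => f0 + (y - z0) * l) z.
Proof.
eexists. apply is_cderive_plus; [apply is_cderive_const|].
apply is_cderive_mult; [|apply is_cderive_const].
apply is_cderive_minus; [apply is_cderive_id|apply is_cderive_const].
Qed.

(* Goursat's theorem: the derivative of [F] is not assumed to be continuous. *)
Lemma homotopy_path_int (F : C -> C) (g gs gt : R -> R -> C) (a b c d K : R) :
  (a <= b)%R -> (c <= d)%R ->
  (forall s t, (a <= s <= b)%R -> (c <= t <= d)%R ->
    ex_cderive F (g s t) /\
    (is_curve_derive (fun s => g s t) s (gs s t) /\ curve_continuous (fun s => gs s t) s) /\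
    (is_curve_derive (g s) t (gt s t) /\ curve_continuous (gt s) t) /\
    (Cmod (gs s t) <= K)%R /\ (Cmod (gt s t) <= K)%R) ->
  (forall s t x y, (a <= s <= b)%R -> (c <= t <= d)%R -> (a <= x <= b)%R -> (c <= y <= d)%R ->
    (Cmod (g s t - g x y) <= K * (Rabs (s - x) + Rabs (t - y)))%R) ->
  path_int F (g b) (gt b) c d - path_int F (g a) (gt a) c d =
  path_int F (fun s => g s d) (fun s => gs s d) a b - path_int F (fun s => g s c) (fun s => gs s c) a b.
Proof.
intros Hab Hcd H HL.
assert (HK : (0 <= K)%R).
{ destruct (H a c) as (_ & _ & _ & HK & _); [lra..|]. eapply Rle_trans; [apply Cmod_ge_0|apply HK]. }
(* The integral of [F] along the image of the counterclockwise boundary of the parameter rectangle.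
   It is additive because a common edge is run through in both directions. *)
set (J := fun s0 s1 t0 t1 =>
  path_int F (g s1) (gt s1) t0 t1 - path_int F (g s0) (gt s0) t0 t1 -
  (path_int F (fun s => g s t1) (fun s => gs s t1) s0 s1 -
   path_int F (fun s => g s t0) (fun s => gs s t0) s0 s1)).
enough (E : J a b c d = 0) by (apply Ceq_minus; exact E).
apply additive_rectangle_function_zero; [| |assumption|assumption|].
- intros s0 s1 s2 t0 t1 ? ? ? ?. unfold J.
  rewrite (path_int_chasles F (fun s => g s t1) _ s0 s1 s2), (path_int_chasles F (fun s => g s t0) _ s0 s1 s2);
    [ring| lra | | lra |].
  + intros s Hs; destruct (H s t0 ltac:(lra) ltac:(lra)) as (? & (? & ?) & _); repeat split; trivial.
    eapply is_curve_derive_continuous; eassumption.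
  + intros s Hs; destruct (H s t1 ltac:(lra) ltac:(lra)) as (? & (? & ?) & _); repeat split; trivial.
    eapply is_curve_derive_continuous; eassumption.
- intros s0 s1 t0 t1 t2 ? ? ? ?. unfold J.
  rewrite (path_int_chasles F (g s1) _ t0 t1 t2), (path_int_chasles F (g s0) _ t0 t1 t2);
    [ring| lra | | lra |].
  + intros t Ht; destruct (H s0 t ltac:(lra) ltac:(lra)) as (? & _ & (? & ?) & _); repeat split; trivial.
    eapply is_curve_derive_continuous; eassumption.
  + intros t Ht; destruct (H s1 t ltac:(lra) ltac:(lra)) as (? & _ & (? & ?) & _); repeat split; trivial.
    eapply is_curve_derive_continuous; eassumption.
- intros x y Hx Hy eps Heps.
  destruct (H x y Hx Hy) as ([l Hl] & _).
  (* Opposite edges together contribute at most twice their side times e K^2 D, where D is the sum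
     of the two sides. The total is 2 e K^2 D^2, at most eps D^2; 1 + K avoids a division by
     zero. *)
  set (e := (eps / (2 * (1 + K) ^ 2))%R).
  assert (He : (0 < e)%R) by (apply Rdiv_lt_0_compat; [lra|nra]).
  destruct (proj1 (is_cderive_eps _ _ _) Hl e He) as [dl [Hdl HF]].
  (* Sides below this number give K D < dl, so the image of the small rectangle stays where the
     linear approximation of [F] is valid. *)
  assert (Hdd : (0 < dl / (2 * (1 + K)))%R) by (apply Rdiv_lt_0_compat; lra).
  exists (dl / (2 * (1 + K)))%R; split; [assumption|].
  intros s0 s1 t0 t1 Hs0 Hs1 Ht0 Ht1 Hds Hdt.
  set (D := ((s1 - s0) + (t1 - t0))%R).
  assert (Near : forall s t, (s0 <= s <= s1)%R -> (t0 <= t <= t1)%R ->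
     (Cmod (F (g s t) - (F (g x y) + (g s t - g x y) * l)) <= e * (K * D))%R).
  { intros s t Hs Ht.
    assert (B : (Cmod (g s t - g x y) <= K * D)%R).
    { eapply Rle_trans; [apply HL; lra|]. apply Rmult_le_compat_l; [assumption|].
      unfold D. apply Rplus_le_compat; apply Rabs_le; lra. }
    replace (F (g s t) - (F (g x y) + (g s t - g x y) * l)) with
      (F (g s t) - F (g x y) - (g s t - g x y) * l) by ring.
    eapply Rle_trans; [apply HF|apply Rmult_le_compat_l; lra].
    eapply Rle_lt_trans; [apply B|].
    assert (E : (2 * (1 + K) * (dl / (2 * (1 + K))) = dl)%R) by (field; lra).
    unfold D. rewrite <- E. nra. }
  set (G := fun w : C => F (g x y) * w + l / 2 * ((w - g x y) * (w - g x y))).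
  assert (Edge_t : forall s, (s0 <= s <= s1)%R ->
     (Cmod (path_int F (g s) (gt s) t0 t1 - (G (g s t1) - G (g s t0))) <= (t1 - t0) * (e * (K * D) * K))%R).
  { intros s Hs. apply path_int_near_primitive with (A := fun w => F (g x y) + (w - g x y) * l); [lra| | |].
    - intros t Ht. destruct (H s t ltac:(lra) ltac:(lra)) as (? & _ & (? & ?) & _). split; [|split]; assumption.
    - intros t Ht; split; [apply is_cderive_affine_primitive|apply ex_cderive_affine].
    - intros t Ht; split; [now apply Near|]. now destruct (H s t ltac:(lra) ltac:(lra)) as (_ & _ & _ & _ & ?). }
  assert (Edge_s : forall t, (t0 <= t <= t1)%R ->
     (Cmod (path_int F (fun s => g s t) (fun s => gs s t) s0 s1 - (G (g s1 t) - G (g s0 t))) <= (s1 - s0) * (e * (K * D) * K))%R).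
  { intros t Ht.
    apply (path_int_near_primitive F (fun w => F (g x y) + (w - g x y) * l) G (fun s => g s t)); [lra| | |].
    - intros s Hs. destruct (H s t ltac:(lra) ltac:(lra)) as (? & (? & ?) & _). split; [|split]; assumption.
    - intros s Hs; split; [apply is_cderive_affine_primitive|apply ex_cderive_affine].
    - intros s Hs; split; [now apply Near|]. now destruct (H s t ltac:(lra) ltac:(lra)) as (_ & _ & _ & ? & _). }
  assert (X1 := Edge_t s1 ltac:(lra)). assert (X2 := Edge_t s0 ltac:(lra)).
  assert (X3 := Edge_s t1 ltac:(lra)). assert (X4 := Edge_s t0 ltac:(lra)).
  revert X1 X2 X3 X4. unfold J.
  generalize (path_int F (g s1) (gt s1) t0 t1) (path_int F (g s0) (gt s0) t0 t1)
    (path_int F (fun s => g s t1) (fun s => gs s t1) s0 s1)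
    (path_int F (fun s => g s t0) (fun s => gs s t0) s0 s1).
  intros p q u v X1 X2 X3 X4.
  (* The increments of [G] around the closed boundary cancel, so only the four approximation errors
     remain. *)
  replace (p - q - (u - v)) with
    (((p - (G (g s1 t1) - G (g s1 t0))) + - (q - (G (g s0 t1) - G (g s0 t0)))) +
     (- (u - (G (g s1 t1) - G (g s0 t1))) + (v - (G (g s1 t0) - G (g s0 t0))))) by ring.
  eapply Rle_trans; [apply Cmod_triangle|].
  eapply Rle_trans; [apply Rplus_le_compat; apply Cmod_triangle|].
  rewrite !Cmod_opp.
  assert (E : (2 * D * (e * (K * D) * K) <= eps * D ^ 2)%R).
  { replace (2 * D * (e * (K * D) * K))%R with ((2 * e * K ^ 2) * D ^ 2)%R by ring.
    apply Rmult_le_compat_r; [apply pow2_ge_0|].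
    replace eps with (2 * e * (1 + K) ^ 2)%R by (unfold e; field; lra).
    apply Rmult_le_compat_l; [lra|]. apply pow_incr; lra. }
  unfold D in *. lra.
Qed.

(** * Cones and circles *)

Lemma curve_continuous_const (c : C) (t : R) : curve_continuous (fun _ => c) t.
Proof. apply continuous_const. Qed.

Lemma curve_lipschitz (g dg : R -> C) (a b K : R) :
  (a <= b)%R ->
  (forall t, (a <= t <= b)%R ->
     is_curve_derive g t (dg t) /\ curve_continuous dg t /\ (Cmod (dg t) <= K)%R) ->
  (Cmod (g b - g a) <= (b - a) * K)%R.
Proof.
intros Hab H. rewrite <- norm_C_R.
apply (@norm_RInt_le_const C_R_NormedModule dg); [assumption| |].
- intros t Ht; rewrite norm_C_R; apply (H t Ht).
- apply (@is_RInt_derive C_R_CompleteNormedModule g);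
  intros t Ht; rewrite Rmin_left, Rmax_right in Ht by assumption; apply (H t Ht).
Qed.

Lemma is_cderive_affine (c l z : C) : is_cderive (fun y => c + l * y) z l.
Proof.
apply is_cderive_eps; intros eps He; exists 1%R; split; [lra|]; intros y _.
replace (c + l * y - (c + l * z) - (y - z) * l) with (RtoC 0) by ring. rewrite Cmod_0.
apply Rmult_le_pos; [lra|apply Cmod_ge_0].
Qed.

(** The homotopy is z + s w(t), scaling the curve towards [z]. It will be used on the circle with s
    away from 0, and on a segment with a = 0, where the cone is a full triangle. *)
Lemma cone_path_int (F : C -> C) (z : C) (w dw : R -> C) (a b c d K : R) :
  (0 <= a <= b)%R -> (b <= 1)%R -> (c <= d)%R ->
  (forall t, (c <= t <= d)%R ->
     is_curve_derive w t (dw t) /\ curve_continuous dw t /\ (Cmod (w t) <= K)%R /\ (Cmod (dw t) <= K)%R) ->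
  (forall s t, (a <= s <= b)%R -> (c <= t <= d)%R -> ex_cderive F (z + s * w t)) ->
  path_int F (fun t => z + b * w t) (fun t => b * dw t) c d -
  path_int F (fun t => z + a * w t) (fun t => a * dw t) c d =
  path_int F (fun s => z + s * w d) (fun _ => w d) a b - path_int F (fun s => z + s * w c) (fun _ => w c) a b.
Proof.
intros Hab Hb Hcd Hw HF.
apply (homotopy_path_int F (fun s t => z + s * w t) (fun s t => w t) (fun s t => s * dw t) a b c d K);
  [lra|assumption| |].
- intros s t Hs Ht. destruct (Hw t Ht) as (H1 & H2 & H3 & H4).
  split; [now apply HF|]. split; [split|split; [split|split]].
  + apply is_curve_derive_eps. intros eps Heps; exists 1%R; split; [lra|]. intros s' _.
    replace (z + s' * w t - (z + s * w t) - RtoC (s' - s) * w t) with (RtoC 0) by (rewrite RtoC_minus; ring).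
    rewrite Cmod_0. apply Rmult_le_pos; [lra|apply Rabs_pos].
  + apply curve_continuous_const.
  + apply (is_curve_derive_comp (fun y => z + s * y)); [apply is_cderive_affine|assumption].
  + apply curve_continuous_mult; [apply curve_continuous_const|assumption].
  + assumption.
  + rewrite Cmod_mult, Cmod_R, Rabs_pos_eq by lra. assert (Q := Cmod_ge_0 (dw t)). nra.
- assert (L : forall t y, (c <= t <= d)%R -> (c <= y <= t)%R -> (Cmod (w t - w y) <= (t - y) * K)%R).
  { intros t y Ht Hy. apply curve_lipschitz with dw; [lra|].
    intros u Hu. destruct (Hw u ltac:(lra)) as (H1 & H2 & H3 & H4). split; [|split]; assumption. }
  assert (L' : forall t y, (c <= t <= d)%R -> (c <= y <= d)%R -> (Cmod (w t - w y) <= K * Rabs (t - y))%R).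
  { intros t y Ht Hy. rewrite Rmult_comm. destruct (Rle_dec y t).
    - rewrite Rabs_pos_eq by lra. apply L; lra.
    - rewrite Rabs_left by lra. rewrite <- Cmod_opp.
      replace (- (w t - w y)) with (w y - w t) by ring.
      replace (- (t - y))%R with (y - t)%R by ring. apply L; lra. }
  intros s t x y Hs Ht Hx Hy.
  destruct (Hw t Ht) as (_ & _ & H3 & _).
  (* First the scale changes at a fixed point of the curve, then the point moves at a fixed scale
     [x], which is at most 1. *)
  replace (z + s * w t - (z + x * w y)) with (RtoC (s - x) * w t + x * (w t - w y))
    by (rewrite RtoC_minus; ring).
  eapply Rle_trans; [apply Cmod_triangle|].
  rewrite !Cmod_mult, !Cmod_R, (Rabs_pos_eq x) by lra.
  specialize (L' t y Ht Hy). assert (Q := Cmod_ge_0 (w t - w y)). assert (Q2 := Rabs_pos (s - x)).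
  nra.
Qed.

Lemma Cmod_le_Re_Im (z : C) : (Cmod z <= Rabs (fst z) + Rabs (snd z))%R.
Proof.
destruct z as [x y]; simpl.
replace (x, y) with (RtoC x + Ci * RtoC y) by (apply injective_projections; simpl; ring).
eapply Rle_trans; [apply Cmod_triangle|].
rewrite Cmod_mult, Cmod_Ci, !Cmod_R. lra.
Qed.

Lemma is_derive_eps (f : R -> R) (t l : R) :
  is_derive f t l ->
  forall eps : R, (0 < eps)%R -> exists d : R, (0 < d)%R /\
    forall s : R, (Rabs (s - t) < d)%R ->
      (Rabs (f s - f t - (s - t) * l) <= eps * Rabs (s - t))%R.
Proof.
intros [_ H] eps Heps.
destruct (H t (fun P HP => HP) (mkposreal eps Heps)) as [d Hd].
exists d; split; [apply cond_pos|].
intros y Hy. exact (Hd y Hy).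
Qed.

Lemma is_curve_derive_pair (f g : R -> R) (t l m : R) :
  is_derive f t l -> is_derive g t m ->
  is_curve_derive (fun s => (f s, g s)) t (l, m).
Proof.
intros Hf Hg. apply is_curve_derive_eps. intros eps Heps.
destruct (is_derive_eps _ _ _ Hf (eps / 2)%R) as [d1 [Hd1 H1]]; [lra|].
destruct (is_derive_eps _ _ _ Hg (eps / 2)%R) as [d2 [Hd2 H2]]; [lra|].
exists (Rmin d1 d2); split; [now apply Rmin_pos|]. intros s Hs.
specialize (H1 s (Rlt_le_trans _ _ _ Hs (Rmin_l _ _))).
specialize (H2 s (Rlt_le_trans _ _ _ Hs (Rmin_r _ _))).
eapply Rle_trans; [apply Cmod_le_Re_Im|]. simpl.
replace (f s + - f t + - ((s - t) * l - 0 * m))%R with (f s - f t - (s - t) * l)%R by ring.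
replace (g s + - g t + - ((s - t) * m + 0 * l))%R with (g s - g t - (s - t) * m)%R by ring.
lra.
Qed.

Definition circle (z : C) (r t : R) : C := z + r * (cos t, sin t).
Definition circle' (r t : R) : C := r * (- sin t, cos t)%R.

Lemma Cmod_cos_sin (t : R) : Cmod (cos t, sin t) = 1%R.
Proof.
unfold Cmod; simpl. rewrite !Rmult_1_r.
replace (cos t * cos t + sin t * sin t)%R with 1%R by (generalize (sin2_cos2 t); unfold Rsqr; lra).
apply sqrt_1.
Qed.

Lemma is_curve_derive_circle (z : C) (r t : R) :
  is_curve_derive (circle z r) t (circle' r t).
Proof.
apply (is_curve_derive_comp (fun y => z + r * y) (fun t => (cos t, sin t))).
- apply is_cderive_affine.
- apply is_curve_derive_pair; [apply is_derive_cos|apply is_derive_sin].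
Qed.

Lemma circle'_continuous (r t : R) : curve_continuous (circle' r) t.
Proof.
apply curve_continuous_mult; [apply curve_continuous_const|].
eapply is_curve_derive_continuous, is_curve_derive_pair; [|apply is_derive_cos].
apply (@is_derive_opp R_AbsRing R_NormedModule), is_derive_sin.
Qed.

Lemma Cmod_circle' (r t : R) : (0 <= r)%R -> Cmod (circle' r t) = r.
Proof.
intros Hr. unfold circle'.
replace ((- sin t)%R, cos t) with (Ci * (cos t, sin t)) by (apply injective_projections; simpl; ring).
rewrite !Cmod_mult, Cmod_Ci, Cmod_cos_sin, Cmod_R, Rabs_pos_eq by assumption. ring.
Qed.

Lemma Cmod_circle_center (z : C) (r t : R) : (0 <= r)%R -> Cmod (circle z r t - z) = r.
Proof.
intros Hr. unfold circle.
replace (z + r * (cos t, sin t) - z) with (r * (cos t, sin t)) by ring.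
rewrite Cmod_mult, Cmod_cos_sin, Cmod_R, Rabs_pos_eq by assumption. ring.
Qed.

Lemma circle_avoids (z0 z : C) (r t : R) : (0 <= r)%R ->
  (r - Cmod (z - z0) <= Cmod (circle z0 r t - z))%R.
Proof.
intros Hr. rewrite <- (Cmod_circle_center z0 r t Hr) at 1.
replace (circle z0 r t - z0) with ((circle z0 r t - z) + (z - z0)) by ring.
generalize (Cmod_triangle (circle z0 r t - z) (z - z0)). lra.
Qed.

(** * Reciprocals and quotients *)

(** Both remainders are exact multiples of h^2, with cofactors 1 / ((u - h) u^2) and the same times
    1 / (u - h) + 2 / u. Since |u - h| is at least rho / 2, the constants follow. They depend on
    [rho] only, which makes them uniform along a curve and allows 1 / u and 1 / u^2 to be
    differentiated under the integral. *)
Lemma Cinv_taylor (u h : C) (rho : R) :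
  (0 < rho)%R -> (rho <= Cmod u)%R -> (Cmod h <= rho / 2)%R ->
  (Cmod (/ (u - h) - / u - h * (/ u * / u)) <= 2 / rho ^ 3 * Cmod h ^ 2)%R /\
  (Cmod (/ (u - h) * / (u - h) - / u * / u - h * (2 * (/ u * (/ u * / u)))) <= 8 / rho ^ 4 * Cmod h ^ 2)%R.
Proof.
intros Hr Hu Hh.
assert (Hu0 : u <> 0) by (apply Cmod_gt_0; lra).
assert (Huh : (rho / 2 <= Cmod (u - h))%R).
{ assert (T := Cmod_triangle (u - h) h). replace (u - h + h) with u in T by ring. lra. }
assert (Huh0 : u - h <> 0) by (apply Cmod_gt_0; lra).
assert (Ha : (Cmod (/ (u - h)) <= 2 / rho)%R).
{ rewrite Cmod_inv by assumption. replace (2 / rho)%R with (/ (rho / 2))%R by (field; lra).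
  apply Rinv_le_contravar; lra. }
assert (Hb : (Cmod (/ u) <= 1 / rho)%R).
{ rewrite Cmod_inv by assumption. unfold Rdiv; rewrite Rmult_1_l. apply Rinv_le_contravar; lra. }
assert (E1 : / (u - h) - / u - h * (/ u * / u) = h * h * (/ (u - h) * (/ u * / u)))
  by (field; split; assumption).
assert (E2 : / (u - h) * / (u - h) - / u * / u - h * (2 * (/ u * (/ u * / u))) =
             h * h * (/ (u - h) * (/ u * / u) * (/ (u - h) + 2 * / u)))
  by (field; split; assumption).
rewrite E1, E2.
assert (Hc : (Cmod (/ (u - h) + 2 * / u) <= 4 / rho)%R).
{ eapply Rle_trans; [apply Cmod_triangle|]. rewrite Cmod_mult, Cmod_R, Rabs_pos_eq by lra.
  replace (4 / rho)%R with (2 / rho + 2 * (1 / rho))%R by (field; lra). lra. }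
assert (Hp : (0 < / rho)%R) by now apply Rinv_0_lt_compat.
rewrite !Cmod_mult.
assert (Hab : (Cmod (/ (u - h)) * (Cmod (/ u) * Cmod (/ u)) <= 2 / rho * (1 / rho * (1 / rho)))%R).
{ repeat apply Rmult_le_compat; try apply Cmod_ge_0; try assumption.
  apply Rmult_le_pos; apply Cmod_ge_0. }
assert (P := Cmod_ge_0 h).
split.
- replace (2 / rho ^ 3 * Cmod h ^ 2)%R with (Cmod h * Cmod h * (2 / rho * (1 / rho * (1 / rho))))%R by (field; lra).
  apply Rmult_le_compat_l; [now apply Rmult_le_pos|assumption].
- replace (8 / rho ^ 4 * Cmod h ^ 2)%R with (Cmod h * Cmod h * (2 / rho * (1 / rho * (1 / rho)) * (4 / rho)))%R by (field; lra).
  apply Rmult_le_compat_l; [now apply Rmult_le_pos|].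
  apply Rmult_le_compat; try assumption; try apply Cmod_ge_0.
  repeat apply Rmult_le_pos; apply Cmod_ge_0.
Qed.

Lemma is_cderive_inv_id (z : C) : z <> 0 -> is_cderive (fun y => / y) z (- (/ z * / z)).
Proof.
intros Hz. apply is_cderive_eps. intros eps Heps.
apply Cmod_gt_0 in Hz. set (rho := Cmod z) in *.
set (B := (2 / rho ^ 3)%R).
assert (HB : (0 < B)%R) by (apply Rdiv_lt_0_compat; [lra|now apply pow_lt]).
exists (Rmin (rho / 2) (eps / B)); split; [apply Rmin_pos; [lra|now apply Rdiv_lt_0_compat]|].
intros y Hy.
assert (Hy1 := Rlt_le_trans _ _ _ Hy (Rmin_l _ _)).
assert (Hy2 := Rlt_le_trans _ _ _ Hy (Rmin_r _ _)).
(* The expansion at u = z with h = z - y, so that u - h is [y]. *)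
destruct (Cinv_taylor z (z - y) rho Hz (Rle_refl _)) as [H _].
{ rewrite <- Cmod_opp. replace (- (z - y)) with (y - z) by ring. lra. }
replace (z - (z - y)) with y in H by ring.
rewrite <- (Cmod_opp (z - y)) in H.
replace (- (z - y)) with (y - z) in H by ring.
replace (/ y - / z - (y - z) * - (/ z * / z)) with (/ y - / z - (z - y) * (/ z * / z)) by ring.
eapply Rle_trans; [apply H|]. fold B.
replace (B * Cmod (y - z) ^ 2)%R with (B * Cmod (y - z) * Cmod (y - z))%R by ring.
apply Rmult_le_compat_r; [apply Cmod_ge_0|].
apply Rmult_le_reg_l with (/ B)%R; [now apply Rinv_0_lt_compat|].
replace (/ B * (B * Cmod (y - z)))%R with (Cmod (y - z)) by (field; lra).
rewrite Rmult_comm. left; exact Hy2.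
Qed.

Lemma is_cderive_inv (f : C -> C) (z l : C) :
  f z <> 0 -> is_cderive f z l -> is_cderive (fun y => / f y) z (l * - (/ f z * / f z)).
Proof.
intros Hz Hf. apply is_cderive_comp; [now apply is_cderive_inv_id|assumption].
Qed.

Lemma ex_cderive_const (c z : C) : ex_cderive (fun _ => c) z.
Proof. eexists; apply is_cderive_const. Qed.

Lemma ex_cderive_id (z : C) : ex_cderive (fun y => y) z.
Proof. eexists; apply is_cderive_id. Qed.

Lemma ex_cderive_minus (f g : C -> C) (z : C) :
  ex_cderive f z -> ex_cderive g z -> ex_cderive (fun y => f y - g y) z.
Proof. intros [l Hl] [m Hm]; eexists; apply is_cderive_minus; eassumption. Qed.

Lemma ex_cderive_mult (f g : C -> C) (z : C) :
  ex_cderive f z -> ex_cderive g z -> ex_cderive (fun y => f y * g y) z.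
Proof. intros [l Hl] [m Hm]; eexists; apply is_cderive_mult; eassumption. Qed.

Lemma ex_cderive_inv (f : C -> C) (z : C) :
  f z <> 0 -> ex_cderive f z -> ex_cderive (fun y => / f y) z.
Proof. intros Hz [l Hl]; eexists; apply is_cderive_inv; eassumption. Qed.

Lemma ex_cderive_div (f g : C -> C) (z : C) :
  g z <> 0 -> ex_cderive f z -> ex_cderive g z -> ex_cderive (fun y => f y / g y) z.
Proof. intros Hz Hf Hg; apply ex_cderive_mult; [|apply ex_cderive_inv]; assumption. Qed.

Lemma ex_cderive_ext_loc (f g : C -> C) (z : C) (d : R) :
  (0 < d)%R -> (forall y, (Cmod (y - z) < d)%R -> f y = g y) ->
  ex_cderive f z -> ex_cderive g z.
Proof. intros Hd H [l Hl]. exists l. now apply is_cderive_ext_loc with f d. Qed.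

(** * Cauchy integrals *)

(** The integral is that of a real normed module, hence only real-linear by construction; the
    complex factor is handled on real and imaginary parts. *)
Lemma is_curve_int_mult (c l : C) (g : R -> C) (a b : R) :
  @is_RInt C_R_NormedModule g a b l -> @is_RInt C_R_NormedModule (fun t => c * g t) a b (c * l).
Proof.
intros H.
assert (H1 := @is_RInt_fct_extend_fst R_NormedModule R_NormedModule g a b l H).
assert (H2 := @is_RInt_fct_extend_snd R_NormedModule R_NormedModule g a b l H).
apply (@is_RInt_fct_extend_pair R_NormedModule R_NormedModule (fun t => c * g t) a b).
- exact (@is_RInt_minus R_NormedModule _ _ _ _ _ _
    (@is_RInt_scal R_NormedModule _ _ _ (fst c) _ H1) (@is_RInt_scal R_NormedModule _ _ _ (snd c) _ H2)).
- exact (@is_RInt_plus R_NormedModule _ _ _ _ _ _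
    (@is_RInt_scal R_NormedModule _ _ _ (fst c) _ H2) (@is_RInt_scal R_NormedModule _ _ _ (snd c) _ H1)).
Qed.

Lemma curve_bounded (g : R -> C) (a b : R) :
  (a <= b)%R -> (forall t, (a <= t <= b)%R -> curve_continuous g t) ->
  exists M : R, (0 <= M)%R /\ forall t, (a <= t <= b)%R -> (Cmod (g t) <= M)%R.
Proof.
intros Hab H.
destruct (continuity_ab_maj (fun t => Cmod (g t)) a b Hab) as [m [Hm _]].
- intros t Ht. apply continuity_pt_locally. intros eps.
  destruct (proj1 (curve_continuous_eps _ _) (H t Ht) eps (cond_pos eps)) as [d [Hd Hg]].
  exists (mkposreal d Hd). intros s Hs. specialize (Hg s Hs).
  assert (T1 := Cmod_triangle (g s - g t) (g t)). assert (T2 := Cmod_triangle (g t - g s) (g s)).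
  replace (g s - g t + g t) with (g s) in T1 by ring.
  replace (g t - g s + g s) with (g t) in T2 by ring.
  rewrite <- (Cmod_opp (g t - g s)) in T2. replace (- (g t - g s)) with (g s - g t) in T2 by ring.
  apply Rabs_lt_between'; lra.
- exists (Cmod (g m)); split; [apply Cmod_ge_0|assumption].
Qed.

(** Differentiation under the integral sign: the quadratic bound is uniform in t, so the remainder
    is at most (b - a) B M |y - z|^2 with M a bound for [p]. As the parameter is subtracted, [k']
    stands for minus the derivative of [k]. *)
Lemma is_cderive_curve_int_kernel (k k' : C -> C) (p g : R -> C) (a b rho B : R) (z : C) :
  (a <= b)%R -> (0 < rho)%R -> (0 <= B)%R ->
  (forall t, (a <= t <= b)%R -> curve_continuous p t /\ curve_continuous g t /\ (rho <= Cmod (g t - z))%R) ->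
  (forall u : C, u <> 0 -> ex_cderive k u /\ ex_cderive k' u) ->
  (forall u h : C, (rho <= Cmod u)%R -> (Cmod h <= rho / 2)%R ->
     (Cmod (k (u - h)%C - k u - h * k' u) <= B * Cmod h ^ 2)%R) ->
  is_cderive (fun y => curve_int (fun t => k (g t - y) * p t) a b) z
    (curve_int (fun t => k' (g t - z) * p t) a b).
Proof.
intros Hab Hr HB Hp Hk Hkk.
destruct (curve_bounded p a b Hab) as [M [HM HpM]]; [intros t Ht; now apply Hp|].
assert (Int : forall (q : C -> C) (y : C), (forall u : C, u <> 0 -> ex_cderive q u) -> (Cmod (y - z) < rho)%R ->
  @is_RInt C_R_NormedModule (fun t => q (g t - y) * p t) a b (curve_int (fun t => q (g t - y) * p t) a b)).
{ intros q y Hq Hy. apply (@RInt_correct C_R_CompleteNormedModule), ex_RInt_continuous.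
  intros t Ht. rewrite Rmin_left, Rmax_right in Ht by assumption.
  destruct (Hp t Ht) as (H1 & H2 & H3).
  apply curve_continuous_mult; [|assumption].
  apply (curve_continuous_comp (fun u => q (u - y)) g); [|assumption].
  destruct (Hq (g t - y)) as [l Hl].
  - apply Cmod_gt_0.
    assert (T := Cmod_triangle (g t - y) (y - z)).
    replace (g t - y + (y - z)) with (g t - z) in T by ring. lra.
  - eexists. apply (is_cderive_comp q (fun u => u - y)); [apply Hl|].
    apply is_cderive_minus; [apply is_cderive_id|apply is_cderive_const]. }
set (Q := (B * M * (b - a))%R).
assert (HQ : (0 <= Q)%R) by (repeat apply Rmult_le_pos; lra).
apply is_cderive_eps. intros eps Heps.
exists (Rmin (rho / 2) (eps / (1 + Q))); split; [apply Rmin_pos; [lra|apply Rdiv_lt_0_compat; lra]|].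
intros y Hy.
assert (Hy1 := Rlt_le_trans _ _ _ Hy (Rmin_l _ _)).
assert (Hy2 := Rlt_le_trans _ _ _ Hy (Rmin_r _ _)).
assert (Hz0 : (Cmod (z - z) < rho)%R) by (replace (z - z) with (RtoC 0) by ring; rewrite Cmod_0; lra).
assert (I1 := Int k y (fun u Hu => proj1 (Hk u Hu)) ltac:(lra)).
assert (I2 := Int k z (fun u Hu => proj1 (Hk u Hu)) Hz0).
assert (I3 := is_curve_int_mult (y - z) _ _ _ _ (Int k' z (fun u Hu => proj2 (Hk u Hu)) Hz0)).
assert (I4 := @is_RInt_minus C_R_NormedModule _ _ _ _ _ _ (@is_RInt_minus C_R_NormedModule _ _ _ _ _ _ I1 I2) I3).
apply Rle_trans with ((b - a) * (B * Cmod (y - z) ^ 2 * M))%R.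
- rewrite <- norm_C_R.
  refine (@norm_RInt_le_const C_R_NormedModule _ a b _ _ Hab _ I4).
  intros t Ht. rewrite norm_C_R. destruct (Hp t Ht) as (H1 & H2 & H3).
  change (Cmod (k (g t - y)%C * p t - k (g t - z)%C * p t - (y - z) * (k' (g t - z)%C * p t)) <= B * Cmod (y - z) ^ 2 * M)%R.
  replace (k (g t - y) * p t - k (g t - z) * p t - (y - z) * (k' (g t - z) * p t)) with
    ((k (g t - z - (y - z)) - k (g t - z) - (y - z) * k' (g t - z)) * p t).
  + rewrite Cmod_mult. apply Rmult_le_compat; try apply Cmod_ge_0; [|now apply HpM].
    apply Hkk; lra.
  + replace (g t - z - (y - z)) with (g t - y) by ring. ring.
- replace ((b - a) * (B * Cmod (y - z) ^ 2 * M))%R with (Q * Cmod (y - z) * Cmod (y - z))%R by (unfold Q; ring).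
  apply Rmult_le_compat_r; [apply Cmod_ge_0|].
  apply Rle_trans with ((1 + Q) * (eps / (1 + Q)))%R; [|right; field; lra].
  apply Rmult_le_compat; try apply Cmod_ge_0; lra.
Qed.

(** The factor 1 / (2 pi i) is left out, since only quotients of two such integrals matter; the
    density [p] contains the velocity. *)
Definition cauchy_int (p g : R -> C) (y : C) : C :=
  curve_int (fun t => / (g t - y) * p t) 0 (2 * PI).
Definition cauchy_int2 (p g : R -> C) (y : C) : C :=
  curve_int (fun t => / (g t - y) * / (g t - y) * p t) 0 (2 * PI).

Lemma cauchy_int_derive (p g : R -> C) (rho : R) (z : C) :
  (0 < rho)%R ->
  (forall t, (0 <= t <= 2 * PI)%R -> curve_continuous p t /\ curve_continuous g t /\ (rho <= Cmod (g t - z))%R) ->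
  is_cderive (cauchy_int p g) z (cauchy_int2 p g z) /\ ex_cderive (cauchy_int2 p g) z.
Proof.
intros Hr H. assert (HPI := PI_RGT_0).
assert (Hi : forall u : C, u <> 0 -> ex_cderive (fun u => / u) u)
  by (intros; apply ex_cderive_inv; [assumption|apply ex_cderive_id]).
assert (Hi2 : forall u : C, u <> 0 -> ex_cderive (fun u => / u * / u) u)
  by (intros; apply ex_cderive_mult; now apply Hi).
split.
- apply (is_cderive_curve_int_kernel (fun u => / u) (fun u => / u * / u) p g 0 (2 * PI) rho (2 / rho ^ 3));
    [lra|assumption| |assumption| |].
  + left; apply Rdiv_lt_0_compat; [lra|now apply pow_lt].
  + intros u Hu; split; [now apply Hi|now apply Hi2].
  + intros u h Hu Hh. now apply Cinv_taylor.
- eexists.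
  apply (is_cderive_curve_int_kernel (fun u => / u * / u) (fun u => 2 * (/ u * (/ u * / u))) p g 0 (2 * PI) rho (8 / rho ^ 4));
    [lra|assumption| |assumption| |].
  + left; apply Rdiv_lt_0_compat; [lra|now apply pow_lt].
  + intros u Hu; split; [now apply Hi2|].
    apply ex_cderive_mult; [apply ex_cderive_const|apply ex_cderive_mult; [now apply Hi|now apply Hi2]].
  + intros u h Hu Hh. now apply Cinv_taylor.
Qed.

Lemma path_int_ext (F : C -> C) (g dg h dh : R -> C) (a b : R) :
  (a <= b)%R -> (forall t, (a <= t <= b)%R -> g t = h t /\ dg t = dh t) ->
  path_int F g dg a b = path_int F h dh a b.
Proof.
intros Hab H. apply (@RInt_ext C_R_CompleteNormedModule).
intros t Ht. rewrite Rmin_left, Rmax_right in Ht by assumption.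
destruct (H t) as [-> ->]; [lra|reflexivity].
Qed.

Lemma convex_disc (z0 z w : C) (r s : R) :
  (0 <= s <= 1)%R -> (Cmod (z - z0) <= r)%R -> (Cmod (z + w - z0) <= r)%R -> (Cmod (z + s * w - z0) <= r)%R.
Proof.
intros Hs H1 H2.
replace (z + s * w - z0) with (RtoC (1 - s) * (z - z0) + s * (z + w - z0)) by (rewrite RtoC_minus; ring).
eapply Rle_trans; [apply Cmod_triangle|].
rewrite !Cmod_mult, !Cmod_R, !Rabs_pos_eq by lra. nra.
Qed.

(* Contract the circle to [z]: the integral is unchanged, and the difference quotient is bounded near [z]. *)
Lemma difference_quotient_circle_int (f : C -> C) (z0 z : C) (r : R) :
  (Cmod (z - z0) < r)%R ->
  (forall y, (Cmod (y - z0) <= r)%R -> ex_cderive f y) ->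
  path_int (fun y => (f y - f z) / (y - z)) (circle z0 r) (circle' r) 0 (2 * PI) = 0.
Proof.
intros Hz Hf. assert (HPI := PI_RGT_0).
assert (Hr : (0 < r)%R) by (generalize (Cmod_ge_0 (z - z0)); lra).
set (F := fun y => (f y - f z) / (y - z)).
set (w := fun t => circle z0 r t - z).
(* The lower bound keeps the scaled circles off [z]; the upper bound shows how far they can be from
   it. *)
assert (Hw : forall t, (r - Cmod (z - z0) <= Cmod (w t) <= 2 * r)%R).
{ intros t; split; [apply circle_avoids; lra|].
  unfold w. replace (circle z0 r t - z) with ((circle z0 r t - z0) + - (z - z0)) by ring.
  eapply Rle_trans; [apply Cmod_triangle|]. rewrite Cmod_opp, Cmod_circle_center by lra. lra. }
assert (Hdw : forall t, is_curve_derive w t (circle' r t)).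
{ intros t. replace (circle' r t) with (RtoC 1 * circle' r t) by ring.
  apply (is_curve_derive_comp (fun y => y - z)); [|apply is_curve_derive_circle].
  replace (RtoC 1) with (RtoC 1 - RtoC 0) by ring.
  apply is_cderive_minus; [apply is_cderive_id|apply is_cderive_const]. }
assert (HF : forall s t, (0 < s <= 1)%R -> ex_cderive F (z + s * w t)).
{ intros s t Hs. apply ex_cderive_div.
  - replace (z + s * w t - z) with (s * w t) by ring.
    apply Cmult_neq_0; [intros E; apply RtoC_inj in E; lra|].
    apply Cmod_gt_0. generalize (Hw t); lra.
  - apply ex_cderive_minus; [|apply ex_cderive_const]. apply Hf, convex_disc; [lra|lra|].
    unfold w. replace (z + (circle z0 r t - z) - z0) with (circle z0 r t - z0) by ring.
    rewrite Cmod_circle_center; lra.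
  - apply ex_cderive_minus; [apply ex_cderive_id|apply ex_cderive_const]. }
assert (Contract : forall s, (0 < s <= 1)%R ->
  path_int F (circle z0 r) (circle' r) 0 (2 * PI) =
  path_int F (fun t => z + s * w t) (fun t => s * circle' r t) 0 (2 * PI)).
{ intros s Hs.
  assert (E := cone_path_int F z w (circle' r) s 1 0 (2 * PI) (2 * r) ltac:(lra) ltac:(lra) ltac:(lra)).
  lapply E; clear E; [intros E; lapply E; clear E|].
  (* The circle is closed, so the two radial edges of the cone coincide and cancel. *)
  - replace (w (2 * PI)%R) with (w 0%R)
      by (unfold w, circle; now rewrite cos_2PI, sin_2PI, cos_0, sin_0).
    intros E. match type of E with ?A - ?B = ?C - ?C => replace (C - C) with (RtoC 0) in E by ring end.
    apply Ceq_minus in E. rewrite <- E. apply path_int_ext; [lra|].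
    intros t Ht; unfold w; split; ring.
  - intros s' t Hs' Ht. apply HF; lra.
  - intros t Ht. split; [apply Hdw|]. split; [apply circle'_continuous|].
    split; [apply Hw|]. rewrite Cmod_circle'; lra. }
destruct (Hf z ltac:(lra)) as [l Hl].
(* Error constant 1 bounds the difference quotient by 1 + |l| at distance less than d from [z]. *)
destruct (proj1 (is_cderive_eps _ _ _) Hl 1%R Rlt_0_1) as [d [Hd Hq]].
assert (Q : forall s, (0 < s <= 1)%R -> (s * (2 * r) < d)%R ->
  (Cmod (path_int F (circle z0 r) (circle' r) 0 (2 * PI)) <= s * (2 * PI * (1 + Cmod l) * r))%R).
{ intros s Hs Hsd. rewrite (Contract s Hs).
  assert (E := path_int_near_primitive F (fun _ => 0) (fun _ => 0) (fun t => z + s * w t)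
    (fun t => s * circle' r t) 0 (2 * PI) (1 + Cmod l) (s * r) ltac:(lra)).
  lapply E; clear E; [intros E; lapply E; clear E; [intros E; lapply E; clear E|]|].
  - intros E. match type of E with (Cmod (?A - _) <= _)%R => replace (A - (0 - 0)) with A in E by ring end.
    eapply Rle_trans; [apply E|right; ring].
  - intros t Ht; split.
    + replace (F (z + s * w t) - 0) with (F (z + s * w t)) by ring.
      set (y := z + s * w t).
      assert (Hy : Cmod (y - z) = (s * Cmod (w t))%R).
      { unfold y. replace (z + s * w t - z) with (s * w t) by ring.
        rewrite Cmod_mult, Cmod_R, Rabs_pos_eq; lra. }
      assert (Hy0 : (0 < Cmod (y - z))%R) by (rewrite Hy; generalize (Hw t); intros; apply Rmult_lt_0_compat; lra).
      assert (Hyd : (Cmod (y - z) < d)%R) by (rewrite Hy; generalize (Hw t); intros; nra).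
      specialize (Hq y Hyd).
      unfold F. rewrite Cmod_div by now apply Cmod_gt_0.
      apply Rmult_le_reg_r with (Cmod (y - z)); [assumption|].
      replace (Cmod (f y - f z) / Cmod (y - z) * Cmod (y - z))%R with (Cmod (f y - f z)) by (field; lra).
      replace (f y - f z) with ((f y - f z - (y - z) * l) + (y - z) * l) by ring.
      eapply Rle_trans; [apply Cmod_triangle|]. rewrite (Cmod_mult (y - z) l). lra.
    + rewrite Cmod_mult, Cmod_R, Cmod_circle', Rabs_pos_eq; lra.
  - intros t Ht; split; [apply is_cderive_const|apply ex_cderive_const].
  - intros t Ht; split; [apply HF; lra|]. split.
    + apply (is_curve_derive_comp (fun y => z + s * y)); [apply is_cderive_affine|apply Hdw].
    + apply curve_continuous_mult; [apply curve_continuous_const|apply circle'_continuous]. }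
destruct (Ceq_dec (path_int F (circle z0 r) (circle' r) 0 (2 * PI)) 0) as [|Hne]; [assumption|exfalso].
apply Cmod_gt_0 in Hne. set (m := Cmod (path_int F (circle z0 r) (circle' r) 0 (2 * PI))) in *.
set (N := (2 * PI * (1 + Cmod l) * r)%R) in Q.
assert (HN : (0 < N)%R) by (generalize (Cmod_ge_0 l); intros; apply Rmult_lt_0_compat; [apply Rmult_lt_0_compat|]; lra).
(* The three bounds keep [s] below 1, put the scaled circle within distance d of [z], and make the
   estimate s N at most m / 2. *)
set (s := Rmin (1 / 2) (Rmin (d / (4 * r)) (m / (2 * N)))).
assert (Hs : (0 < s)%R) by (repeat apply Rmin_pos; try lra; apply Rdiv_lt_0_compat; lra).
assert (Hs1 : (s <= 1 / 2)%R) by apply Rmin_l.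
assert (Hs2 : (s <= d / (4 * r))%R) by (eapply Rle_trans; [apply Rmin_r|apply Rmin_l]).
assert (Hs3 : (s <= m / (2 * N))%R) by (eapply Rle_trans; [apply Rmin_r|apply Rmin_r]).
apply Rmult_le_compat_r with (r := (2 * r)%R) in Hs2; [|lra].
replace (d / (4 * r) * (2 * r))%R with (d / 2)%R in Hs2 by (field; lra).
apply Rmult_le_compat_r with (r := N) in Hs3; [|lra].
replace (m / (2 * N) * N)%R with (m / 2)%R in Hs3 by (field; lra).
specialize (Q s ltac:(lra) ltac:(lra)). lra.
Qed.

(** The difference quotient integrates to 0, so [f z] can replace f in the numerator. The integral
    multiplying [f z] is left unevaluated. *)
Lemma cauchy_formula (f : C -> C) (z0 z : C) (r : R) :
  (Cmod (z - z0) < r)%R ->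
  (forall y, (Cmod (y - z0) <= r)%R -> ex_cderive f y) ->
  f z * cauchy_int (circle' r) (circle z0 r) z =
  cauchy_int (fun t => f (circle z0 r t) * circle' r t) (circle z0 r) z.
Proof.
intros Hz Hf. assert (HPI := PI_RGT_0).
assert (Hr : (0 < r)%R) by (generalize (Cmod_ge_0 (z - z0)); lra).
assert (Hne : forall t, circle z0 r t - z <> 0).
{ intros t. apply Cmod_gt_0. generalize (circle_avoids z0 z r t); lra. }
assert (J : forall t, ex_cderive (fun y => / (y - z)) (circle z0 r t)).
{ intros t. apply ex_cderive_inv; [apply Hne|].
  apply ex_cderive_minus; [apply ex_cderive_id|apply ex_cderive_const]. }
assert (Cc : forall t, curve_continuous (circle z0 r) t)
  by (intros t; eapply is_curve_derive_continuous, is_curve_derive_circle).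
assert (I1 : @is_RInt C_R_NormedModule (fun t => / (circle z0 r t - z) * circle' r t) 0 (2 * PI)
   (cauchy_int (circle' r) (circle z0 r) z)).
{ apply (is_path_int (fun y => / (y - z))); [lra|].
  intros t Ht; split; [apply J|split; [apply Cc|apply circle'_continuous]]. }
assert (I2 : @is_RInt C_R_NormedModule (fun t => (f (circle z0 r t) - f z) / (circle z0 r t - z) * circle' r t) 0 (2 * PI) (RtoC 0)).
{ rewrite <- (difference_quotient_circle_int f z0 z r Hz Hf).
  apply (is_path_int (fun y => (f y - f z) / (y - z))); [lra|].
  intros t Ht; split; [|split; [apply Cc|apply circle'_continuous]].
  apply ex_cderive_mult; [|apply J].
  apply ex_cderive_minus; [|apply ex_cderive_const].
  apply Hf. rewrite Cmod_circle_center; lra. }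
assert (I3 := @is_RInt_plus C_R_NormedModule _ _ _ _ _ _ I2 (is_curve_int_mult (f z) _ _ _ _ I1)).
symmetry. apply (@is_RInt_unique C_R_CompleteNormedModule).
replace (f z * cauchy_int (circle' r) (circle z0 r) z) with (0 + f z * cauchy_int (circle' r) (circle z0 r) z) by ring.
eapply is_RInt_ext; [|exact I3].
intros t _. unfold Cdiv.
change ((f (circle z0 r t) - f z) * / (circle z0 r t - z) * circle' r t + f z * (/ (circle z0 r t - z) * circle' r t) =
  / (circle z0 r t - z) * (f (circle z0 r t) * circle' r t)). ring.
Qed.

(** At the centre the integrand is the constant [Ci], so the integral is 2 pi i. *)
Lemma cauchy_int_center (z0 : C) (r : R) :
  (0 < r)%R -> cauchy_int (circle' r) (circle z0 r) z0 <> 0.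
Proof.
intros Hr. assert (HPI := PI_RGT_0).
assert (E : cauchy_int (circle' r) (circle z0 r) z0 = RtoC (2 * PI) * Ci).
{ apply (@is_RInt_unique C_R_CompleteNormedModule).
  replace (RtoC (2 * PI) * Ci) with (@scal _ C_R_NormedModule (2 * PI - 0)%R Ci)
    by (rewrite scal_R_Cmult; now rewrite Rminus_0_r).
  eapply is_RInt_ext; [|apply (@is_RInt_const C_R_NormedModule)].
  intros t _. unfold circle, circle'.
  replace ((- sin t)%R, cos t) with (Ci * (cos t, sin t)) by (apply injective_projections; simpl; ring).
  assert (Hr0 : RtoC r <> 0) by (intros H; apply RtoC_inj in H; lra).
  assert (He : ((cos t, sin t) : C) <> 0) by (apply Cmod_gt_0; rewrite Cmod_cos_sin; lra).
  set (e := (cos t, sin t) : C) in *. symmetry.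
  change (/ (z0 + r * e - z0) * (r * (Ci * e)) = Ci). field.
  replace (z0 + r * e - z0) with (r * e) by ring. now apply Cmult_neq_0. }
rewrite E. apply Cmult_neq_0; [intros H; apply RtoC_inj in H; lra|apply Ci_nz].
Qed.

(** Differentiating f W = T gives f' = (T2 - f W2) / W near [z0], a quotient of functions that are
    differentiable at [z0]. *)
Lemma ex_cderive_C_derive (f : C -> C) (z0 : C) (R0 : R) :
  (0 < R0)%R ->
  (forall y, (Cmod (y - z0) < R0)%R -> ex_cderive f y) ->
  ex_cderive (C_derive f) z0.
Proof.
intros HR Hf. set (r := (R0 / 2)%R). assert (Hr : (0 < r < R0)%R) by (unfold r; lra).
set (g := circle z0 r).
set (W := cauchy_int (circle' r) g). set (W2 := cauchy_int2 (circle' r) g).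
set (p := fun t => f (g t) * circle' r t).
set (T := cauchy_int p g). set (T2 := cauchy_int2 p g).
assert (Cc : forall t, curve_continuous g t)
  by (intros t; eapply is_curve_derive_continuous, is_curve_derive_circle).
assert (Pc : forall t, curve_continuous p t).
{ intros t. apply curve_continuous_mult; [|apply circle'_continuous].
  apply curve_continuous_comp; [|apply Cc]. apply Hf.
  unfold g; rewrite Cmod_circle_center; lra. }
assert (DW : forall y, (Cmod (y - z0) < r)%R -> is_cderive W y (W2 y) /\ ex_cderive W2 y).
{ intros y Hy. apply cauchy_int_derive with (r - Cmod (y - z0))%R; [lra|].
  intros t _; split; [apply circle'_continuous|split; [apply Cc|apply circle_avoids; lra]]. }
assert (DT : forall y, (Cmod (y - z0) < r)%R -> is_cderive T y (T2 y) /\ ex_cderive T2 y).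
{ intros y Hy. apply cauchy_int_derive with (r - Cmod (y - z0))%R; [lra|].
  intros t _; split; [apply Pc|split; [apply Cc|apply circle_avoids; lra]]. }
assert (H0 : (Cmod (z0 - z0) < r)%R) by (replace (z0 - z0) with (RtoC 0) by ring; rewrite Cmod_0; lra).
assert (HW0 : W z0 <> 0) by (apply cauchy_int_center; lra).
assert (HW0' := HW0). apply Cmod_gt_0 in HW0'.
(* Within tolerance |W z0| of its value at [z0], [W] cannot vanish. *)
destruct (is_cderive_continuous W z0 (ex_intro _ _ (proj1 (DW z0 H0))) (Cmod (W z0)) HW0') as [d [Hd HWd]].
apply ex_cderive_ext_loc with (f := fun y => (T2 y - f y * W2 y) / W y) (d := Rmin d r).
- apply Rmin_pos; lra.
- intros y Hy.
  assert (Hy1 := Rlt_le_trans _ _ _ Hy (Rmin_l _ _)).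
  assert (Hy2 := Rlt_le_trans _ _ _ Hy (Rmin_r _ _)).
  assert (HWy : W y <> 0).
  { intros E. specialize (HWd y Hy1). rewrite E in HWd.
    replace (0 - W z0) with (- W z0) in HWd by ring. rewrite Cmod_opp in HWd. lra. }
  destruct (Hf y ltac:(lra)) as [l Hl].
  assert (Efy : C_derive f y = l) by now apply is_C_derive_unique.
  assert (P := is_cderive_mult _ _ _ _ _ Hl (proj1 (DW y Hy2))).
  apply (is_cderive_ext_loc _ T _ _ (r - Cmod (y - z0))) in P; [|lra|].
  + apply is_C_derive_unique in P. rewrite (is_C_derive_unique _ _ _ (proj1 (DT y Hy2))) in P.
    rewrite P, Efy. field. assumption.
  + intros u Hu. apply cauchy_formula.
    * replace (u - z0) with ((u - y) + (y - z0)) by ring.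
      generalize (Cmod_triangle (u - y) (y - z0)); lra.
    * intros v Hv; apply Hf; lra.
- apply ex_cderive_div; [assumption| |now exists (W2 z0); apply DW].
  apply ex_cderive_minus; [now apply DT|].
  apply ex_cderive_mult; [apply Hf; lra|now apply DW].
Qed.

(** * Holomorphic functions on the unit disc *)

Lemma unit_disc_open (z y : C) : unit_disc z -> (Cmod (y - z) < 1 - Cmod z)%R -> unit_disc y.
Proof.
unfold unit_disc; intros Hz Hy.
assert (T := Cmod_triangle (y - z) z). replace (y - z + z) with y in T by ring. lra.
Qed.

Lemma is_cderive_ext_disc (f g : C -> C) (z l : C) :
  (forall y, unit_disc y -> f y = g y) -> unit_disc z -> is_cderive f z l -> is_cderive g z l.
Proof.
intros H Hz. apply is_cderive_ext_loc with (1 - Cmod z)%R; [unfold unit_disc in Hz; lra|].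
intros y Hy; apply H, unit_disc_open with z; assumption.
Qed.

Lemma C_derive_ext_disc (f g : C -> C) (z : C) :
  (forall y, unit_disc y -> f y = g y) -> unit_disc z -> ex_cderive g z -> C_derive f z = C_derive g z.
Proof.
intros H Hz [l Hl]. rewrite (is_C_derive_unique g z l Hl). apply is_C_derive_unique.
apply is_cderive_ext_disc with g; [|assumption|assumption]. intros y Hy; symmetry; now apply H.
Qed.

Lemma holomorphic_C_derive (f : C -> C) :
  holomorphic_on unit_disc f -> holomorphic_on unit_disc (C_derive f).
Proof.
intros Hf z Hz. apply ex_cderive_C_derive with (1 - Cmod z)%R.
- unfold unit_disc in Hz; lra.
- intros y Hy. apply Hf. now apply unit_disc_open with z.
Qed.

Lemma is_cderive_C_derive (f : C -> C) (z : C) :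
  holomorphic_on unit_disc f -> unit_disc z -> is_cderive f z (C_derive f z).
Proof. intros Hf Hz. apply (C_derive_correct f z z). now apply Hf. Qed.

(** Disposes of the edge of a cone that is collapsed to the vertex. *)
Lemma path_int_zero_speed (F : C -> C) (g dg : R -> C) (a b : R) :
  (forall t, dg t = 0) -> path_int F g dg a b = 0.
Proof.
intros H. unfold path_int. apply (@is_RInt_unique C_R_CompleteNormedModule).
replace (RtoC 0) with (@scal _ C_R_NormedModule (b - a)%R (RtoC 0)) by (rewrite scal_R_Cmult; apply Cmult_0_r).
eapply is_RInt_ext; [|apply (@is_RInt_const C_R_NormedModule)].
intros t _. rewrite H. change (RtoC 0 = F (g t) * 0). ring.
Qed.

(** The primitive is the integral along the segment from 0. By Goursat's theorem on the triangle 0,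
    z, y its increment is the integral of [f] from z to y, which continuity compares with (y - z)
    f(z). *)
Lemma holomorphic_primitive (f : C -> C) :
  holomorphic_on unit_disc f -> exists L : C -> C, forall z, unit_disc z -> is_cderive L z (f z).
Proof.
intros Hf.
(* The summand 0 is the vertex, so that the path has the shape of a radial edge in
   [cone_path_int]. *)
exists (fun z => path_int f (fun s => 0 + s * z) (fun _ => z) 0 1).
intros z Hz. apply is_cderive_eps. intros eps Heps.
destruct (is_cderive_continuous f z (Hf z Hz) eps Heps) as [d [Hd Hc]].
exists (Rmin d (1 - Cmod z)); split; [apply Rmin_pos; unfold unit_disc in Hz; lra|].
intros y Hy.
assert (Hy1 := Rlt_le_trans _ _ _ Hy (Rmin_l _ _)).
assert (Hy2 := Rlt_le_trans _ _ _ Hy (Rmin_r _ _)).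
assert (Hz1 := Cmod_ge_0 z). unfold unit_disc in Hz.
(* The side of the triangle opposite to 0. *)
set (w := fun t : R => z + (y - z) * t).
assert (Near : forall t, (0 <= t <= 1)%R -> (Cmod (w t - z) <= Cmod (y - z))%R).
{ intros t Ht. unfold w. replace (z + (y - z) * t - z) with (t * (y - z)) by ring.
  rewrite Cmod_mult, Cmod_R, Rabs_pos_eq by lra. generalize (Cmod_ge_0 (y - z)); intros; nra. }
assert (Hwd : forall t, (0 <= t <= 1)%R -> unit_disc (w t)).
{ intros t Ht. apply unit_disc_open with z; [assumption|]. specialize (Near t Ht). lra. }
assert (Dw : forall t, is_curve_derive w t (y - z)).
{ intros t. apply is_curve_derive_eps; intros e He; exists 1%R; split; [lra|]; intros s _.
  unfold w. replace (z + (y - z) * s - (z + (y - z) * t) - RtoC (s - t) * (y - z)) with (RtoC 0)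
    by (rewrite RtoC_minus; ring).
  rewrite Cmod_0. apply Rmult_le_pos; [lra|apply Rabs_pos]. }
assert (E := cone_path_int f 0 w (fun _ => y - z) 0 1 0 1 1 ltac:(lra) ltac:(lra) ltac:(lra)).
lapply E; clear E; [intros E; lapply E; clear E; [intros E|]|].
- rewrite (path_int_zero_speed f (fun t => 0 + 0%R * w t)) in E by (intros; ring).
  replace (w 1%R) with y in E by (unfold w; ring).
  replace (w 0%R) with z in E by (unfold w; ring).
  rewrite <- E.
  rewrite (path_int_ext f _ _ w (fun _ => y - z)) by (lra || (intros; split; ring)).
  assert (P := path_int_near_primitive f (fun _ => f z) (fun u => 0 + f z * u) w (fun _ => y - z) 0 1 eps (Cmod (y - z)) ltac:(lra)).
  lapply P; clear P; [intros P; lapply P; clear P; [intros P; lapply P; clear P|]|].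
  + intros P. replace (w 1%R) with y in P by (unfold w; ring).
    replace (w 0%R) with z in P by (unfold w; ring).
    match type of P with (Cmod (?A - _) <= _)%R =>
      replace (A - (0 + f z * y - (0 + f z * z))) with (A - 0 - (y - z) * f z) in P by ring end.
    eapply Rle_trans; [apply P|right; ring].
  + intros t Ht; split; [|lra]. left. apply Hc. specialize (Near t Ht). lra.
  + intros t Ht; split; [apply is_cderive_affine|apply ex_cderive_const].
  + intros t Ht; split; [now apply Hf, Hwd|split; [apply Dw|apply curve_continuous_const]].
- intros s t Hs Ht. apply Hf. unfold unit_disc. replace (0 + s * w t) with (s * w t) by ring.
  rewrite Cmod_mult, Cmod_R, Rabs_pos_eq by lra. specialize (Hwd t Ht). unfold unit_disc in Hwd.
  generalize (Cmod_ge_0 (w t)); intros; nra.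
- intros t Ht; split; [apply Dw|split; [apply curve_continuous_const|split]].
  + left. now apply Hwd.
  + lra.
Qed.

(** Along the radius from 0 to z, [f] has speed 0 and is therefore Lipschitz with constant 0. *)
Lemma derive_zero_constant (f : C -> C) :
  (forall z, unit_disc z -> is_cderive f z (RtoC 0)) ->
  forall z, unit_disc z -> f z = f 0.
Proof.
intros Hf z Hz.
assert (E := curve_lipschitz (fun t : R => f (0 + z * t)) (fun _ => 0) 0 1 0 ltac:(lra)).
lapply E; clear E.
- intros E. rewrite Rmult_0_r in E. replace (0 + z * 1%R) with z in E by ring.
  replace (0 + z * 0%R) with (RtoC 0) in E by ring.
  apply Ceq_minus, Cmod_eq_0. generalize (Cmod_ge_0 (f z - f 0)); lra.
- intros t Ht. split; [|split; [apply curve_continuous_const|rewrite Cmod_0; lra]].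
  assert (P : is_curve_derive (fun t : R => f (0 + z * t)) t (0 * z)); [|now rewrite Cmult_0_l in P].
  apply (is_curve_derive_comp f (fun t : R => 0 + z * t)).
  + apply Hf. unfold unit_disc in *. replace (0 + z * t) with (t * z) by ring.
    rewrite Cmod_mult, Cmod_R, Rabs_pos_eq by lra. generalize (Cmod_ge_0 z); intros; nra.
  + apply is_curve_derive_eps; intros e He; exists 1%R; split; [lra|]; intros s _.
    replace (0 + z * s - (0 + z * t) - RtoC (s - t) * z) with (RtoC 0) by (rewrite RtoC_minus; ring).
    rewrite Cmod_0. apply Rmult_le_pos; [lra|apply Rabs_pos].
Qed.

(** * Complex exponential and square roots *)

Definition Cexp (z : C) : C := exp (fst z) * (cos (snd z), sin (snd z)).

Lemma Cexp_plus (z w : C) : Cexp (z + w) = Cexp z * Cexp w.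
Proof.
unfold Cexp; simpl. rewrite exp_plus, cos_plus, sin_plus.
apply injective_projections; simpl; ring.
Qed.

Lemma Cexp_nonzero (z : C) : Cexp z <> 0.
Proof.
apply Cmult_neq_0.
- intros E; apply RtoC_inj in E. generalize (exp_pos (fst z)); lra.
- apply Cmod_gt_0. rewrite Cmod_cos_sin; lra.
Qed.

Lemma is_cderive_Cexp_0 : is_cderive Cexp (RtoC 0) (RtoC 1).
Proof.
apply is_cderive_eps. intros eps Heps.
(* For h = a + ib and u = cos b + i sin b, the error is (e^a - 1 - a) u + a (u - 1) + (u - 1 - ib).
   Each term gets eps / 3; for the middle one, |u - 1| is at most 2 |h|, whence the radius eps / 6
   below. *)
set (e := Rmin 1 (eps / 3)).
assert (He : (0 < e)%R) by (apply Rmin_pos; lra).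
assert (He1 : (e <= 1)%R) by apply Rmin_l.
assert (He2 : (e <= eps / 3)%R) by apply Rmin_r.
destruct (is_derive_eps exp 0 1) with (eps := e) as [d1 [Hd1 H1]]; [|assumption|].
{ generalize (is_derive_exp 0). now rewrite exp_0. }
assert (U := is_curve_derive_pair cos sin 0 _ _ (is_derive_cos 0) (is_derive_sin 0)).
rewrite sin_0, cos_0, Ropp_0 in U.
destruct (proj1 (is_curve_derive_eps _ _ _) U e He) as [d2 [Hd2 H2]].
exists (Rmin (eps / 6) (Rmin d1 d2)); split; [repeat apply Rmin_pos; lra|].
intros h Hh. replace (h - 0) with h in * by ring.
assert (Hh0 := Rlt_le_trans _ _ _ Hh (Rmin_l _ _)).
assert (Hh' := Rlt_le_trans _ _ _ Hh (Rmin_r _ _)).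
assert (Hh1 := Rlt_le_trans _ _ _ Hh' (Rmin_l _ _)).
assert (Hh2 := Rlt_le_trans _ _ _ Hh' (Rmin_r _ _)).
assert (Ha : (Rabs (fst h) <= Cmod h)%R) by (eapply Rle_trans; [apply Rmax_l|apply Rmax_Cmod]).
assert (Hb : (Rabs (snd h) <= Cmod h)%R) by (eapply Rle_trans; [apply Rmax_r|apply Rmax_Cmod]).
destruct h as [a b]; simpl in Ha, Hb.
specialize (H1 a). specialize (H2 b). rewrite Rminus_0_r in H1, H2.
specialize (H1 ltac:(lra)). specialize (H2 ltac:(lra)).
rewrite exp_0, Rmult_1_r in H1. rewrite cos_0, sin_0 in H2.
unfold Cexp; simpl.
assert (Hu := Cmod_cos_sin b).
set (u := (cos b, sin b) : C) in *.
rewrite exp_0, cos_0, sin_0.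
change (1%R, 0%R) with (RtoC 1) in *. change (0%R, 1%R) with Ci in *.
assert (Hab : ((a, b) : C) = a + b * Ci) by (apply injective_projections; simpl; ring).
assert (Hu1 : (Cmod (u - 1) <= 2 * Cmod (a, b))%R).
{ replace (u - 1) with ((u - 1 - b * Ci) + b * Ci) by ring.
  eapply Rle_trans; [apply Cmod_triangle|]. rewrite Cmod_mult, Cmod_Ci, Cmod_R.
  assert (Q := Rabs_pos b). nra. }
replace (exp a * u - 1 * 1 - (a, b) * 1) with
  (RtoC (exp a - 1 - a) * u + a * (u - 1) + (u - 1 - b * Ci)).
- eapply Rle_trans; [apply Cmod_triangle|].
  eapply Rle_trans; [apply Rplus_le_compat_r, Cmod_triangle|].
  rewrite !Cmod_mult, !Cmod_R, Hu.
  assert (Q := Cmod_ge_0 (a, b)). assert (Q2 := Cmod_ge_0 (u - 1)). assert (Q3 := Rabs_pos a).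
  assert (Q4 := Rabs_pos b).
  assert (T1 : (e * Rabs a <= eps / 3 * Cmod (a, b))%R) by (apply Rmult_le_compat; lra).
  assert (T2 : (e * Rabs b <= eps / 3 * Cmod (a, b))%R) by (apply Rmult_le_compat; lra).
  assert (T3 : (Rabs a * Cmod (u - 1) <= eps / 6 * (2 * Cmod (a, b)))%R) by (apply Rmult_le_compat; lra).
  lra.
- rewrite Hab, !RtoC_minus. ring.
Qed.

(** The functional equation carries the derivative at 0 over to [z]. *)
Lemma is_cderive_Cexp (z : C) : is_cderive Cexp z (Cexp z).
Proof.
apply is_cderive_ext_loc with (f := fun y => Cexp z * Cexp (y - z)) (d := 1%R); [lra| |].
- intros y _. rewrite <- Cexp_plus. f_equal; ring.
- assert (D : is_cderive (fun y => Cexp (y - z)) z ((1 - 0) * 1)).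
  { apply (is_cderive_comp Cexp (fun y => y - z)).
    - replace (z - z) with (RtoC 0) by ring. apply is_cderive_Cexp_0.
    - apply is_cderive_minus; [apply is_cderive_id|apply is_cderive_const]. }
  assert (P := is_cderive_mult _ _ _ _ _ (is_cderive_const (Cexp z) z) D).
  simpl in P. match type of P with is_derive _ _ ?v => replace v with (Cexp z) in P by ring; exact P end.
Qed.

(** For v = a + ib the squares of the real and imaginary parts of the root are (|v| + a) / 2 and
    (|v| - a) / 2; the sign of [b] decides the sign of the imaginary part. *)
Lemma Csqrt_exists (v : C) : exists c : C, c * c = v.
Proof.
destruct v as [a b].
assert (Hm := Rmax_Cmod (a, b)). simpl in Hm.
assert (Ha : (Rabs a <= Cmod (a, b))%R) by (eapply Rle_trans; [apply Rmax_l|apply Hm]).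
apply Rabs_le_between in Ha.
assert (Hn : (Cmod (a, b) * Cmod (a, b) = a * a + b * b)%R).
{ generalize (Cmod2_alt (a, b)); simpl; lra. }
set (n := Cmod (a, b)) in *.
set (p := sqrt ((n + a) / 2)). set (q := sqrt ((n - a) / 2)).
assert (Hp : (p * p = (n + a) / 2)%R) by (apply sqrt_sqrt; lra).
assert (Hq : (q * q = (n - a) / 2)%R) by (apply sqrt_sqrt; lra).
assert (Hpq : (2 * (p * q) = Rabs b)%R).
{ unfold p, q. rewrite <- sqrt_mult by lra.
  replace ((n + a) / 2 * ((n - a) / 2))%R with (Rsqr (b / 2)) by (unfold Rsqr; nra).
  rewrite sqrt_Rsqr_abs. unfold Rdiv. rewrite Rabs_mult, (Rabs_pos_eq (/ 2)); lra. }
destruct (Rle_dec 0 b) as [Hb|Hb].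
- exists (p, q). rewrite Rabs_pos_eq in Hpq by assumption.
  apply injective_projections; simpl; lra.
- exists (p, (- q)%R). rewrite Rabs_left in Hpq by lra.
  apply injective_projections; simpl; lra.
Qed.

(* [x' exp (-L)] is constant when [L' = x'' / x'], so [c exp (-L / 2)] has square [1 / x'] for a suitable [c]. *)
Lemma holomorphic_inv_sqrt (u : C -> C) :
  holomorphic_on unit_disc u -> (forall z, unit_disc z -> u z <> 0) ->
  exists mu : C -> C, holomorphic_on unit_disc mu /\
    forall z, unit_disc z -> mu z * mu z * u z = 1.
Proof.
intros Hu Hu0.
destruct (holomorphic_primitive (fun z => C_derive u z / u z)) as [L HL].
{ intros z Hz. apply ex_cderive_div; [now apply Hu0|now apply holomorphic_C_derive|now apply Hu]. }
(* Used with k = -1 for the constancy of u exp(-L) and with k = -1/2 for the square root. *)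
assert (D : forall k z, unit_disc z -> is_cderive (fun y => Cexp (0 + k * L y)) z
   ((C_derive u z / u z * k) * Cexp (0 + k * L z))).
{ intros k z Hz. apply (is_cderive_comp Cexp (fun y => 0 + k * L y)); [apply is_cderive_Cexp|].
  apply (is_cderive_comp (fun y => 0 + k * y) L); [apply is_cderive_affine|now apply HL]. }
assert (Cst := derive_zero_constant (fun z => u z * Cexp (0 + - (1) * L z))).
lapply Cst; clear Cst; [intros Cst|].
- set (v := u 0 * Cexp (0 + - (1) * L 0)) in *.
  assert (H0 : unit_disc 0) by (unfold unit_disc; rewrite Cmod_0; lra).
  assert (Hv : v <> 0) by (apply Cmult_neq_0; [now apply Hu0|apply Cexp_nonzero]).
  (* As u exp(-L) has the constant value [v], the product mu^2 u equals c^2 v. *)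
  destruct (Csqrt_exists (/ v)) as [c Hc].
  exists (fun z => c * Cexp (0 + - (1 / 2) * L z)); split.
  + intros z Hz. apply ex_cderive_mult; [apply ex_cderive_const|]. eexists; now apply D.
  + intros z Hz.
    replace (c * Cexp (0 + - (1 / 2) * L z) * (c * Cexp (0 + - (1 / 2) * L z)) * u z) with
      ((c * c) * (u z * (Cexp (0 + - (1 / 2) * L z) * Cexp (0 + - (1 / 2) * L z)))) by ring.
    rewrite <- Cexp_plus.
    replace (0 + - (1 / 2) * L z + (0 + - (1 / 2) * L z)) with (0 + - (1) * L z) by field.
    rewrite (Cst z Hz), Hc. now apply Cinv_l.
- intros z Hz.
  assert (P := is_cderive_mult _ _ _ _ _ (is_cderive_C_derive u z Hu Hz) (D (- (1)) z Hz)).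
  simpl in P. match type of P with is_derive _ _ ?v => replace v with (RtoC 0) in P; [exact P|] end.
  field. now apply Hu0.
Qed.

(** * The second-order equation and the curvature *)

Definition schwarzian_formula (x : C -> C) (z : C) : C :=
  3 / 4 * (C_derive (C_derive x) z / C_derive x z) ^ 2
  - 1 / 2 * (C_derive (C_derive (C_derive x)) z / C_derive x z).

Lemma schwarzian_equation (x mu : C -> C) :
  holomorphic_on unit_disc x -> (forall z, unit_disc z -> C_derive x z <> 0) ->
  holomorphic_on unit_disc mu -> (forall z, unit_disc z -> mu z * mu z * C_derive x z = 1) ->
  forall z, unit_disc z ->
    C_derive (C_derive mu) z = schwarzian_formula x z * mu z /\
    C_derive (C_derive (fun y => mu y * x y)) z = schwarzian_formula x z * (mu z * x z).
Proof.
intros Hx Hx0 Hmu Hn.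
assert (Hx1 := holomorphic_C_derive _ Hx). assert (Hx2 := holomorphic_C_derive _ Hx1).
assert (Hmu1 := holomorphic_C_derive _ Hmu).
assert (Hmu0 : forall z, unit_disc z -> mu z <> 0).
{ intros z Hz E. specialize (Hn z Hz). rewrite E in Hn.
  replace (0 * 0 * C_derive x z) with (RtoC 0) in Hn by ring. apply RtoC_inj in Hn. lra. }
assert (E1 : forall z, unit_disc z ->
  C_derive mu z = - (1 / 2) * (mu z * (C_derive (C_derive x) z / C_derive x z))).
{ intros z Hz.
  assert (D := is_cderive_C_derive mu z Hmu Hz).
  assert (P := is_cderive_mult _ _ _ _ _ (is_cderive_mult _ _ _ _ _ D D) (is_cderive_C_derive _ z Hx1 Hz)).
  apply (is_cderive_ext_disc _ (fun _ => 1)) in P; [|assumption|assumption].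
  apply is_C_derive_unique in P.
  assert (Z : C_derive (fun _ => RtoC 1) z = 0) by (apply is_C_derive_unique, is_cderive_const).
  rewrite Z in P; clear Z.
  specialize (Hmu0 z Hz); specialize (Hx0 z Hz).
  (* The derivative of mu^2 x' = 1 is multiplied out as 2 mu x' times the wanted difference, and 2
     mu x' is not zero. *)
  assert (E : 2 * mu z * C_derive x z * (C_derive mu z - - (1 / 2) * (mu z * (C_derive (C_derive x) z / C_derive x z))) = 0).
  { rewrite P. field. assumption. }
  apply Ceq_minus. destruct (Ceq_dec (C_derive mu z - - (1 / 2) * (mu z * (C_derive (C_derive x) z / C_derive x z))) 0)
    as [|Hne]; [assumption|exfalso].
  revert E. repeat apply Cmult_neq_0; try assumption. intros E; apply RtoC_inj in E; lra. }
assert (E2 : forall z, unit_disc z -> C_derive (C_derive mu) z = schwarzian_formula x z * mu z).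
{ intros z Hz. apply is_C_derive_unique.
  eapply is_cderive_ext_disc; [intros y Hy; symmetry; now apply E1|assumption|].
  assert (P := is_cderive_mult _ _ _ _ _ (is_cderive_const (- (1 / 2)) z)
   (is_cderive_mult _ _ _ _ _ (is_cderive_C_derive mu z Hmu Hz)
     (is_cderive_mult _ _ _ _ _ (is_cderive_C_derive _ z Hx2 Hz)
       (is_cderive_inv _ _ _ (Hx0 z Hz) (is_cderive_C_derive _ z Hx1 Hz))))).
  simpl in P. match type of P with is_derive _ _ ?v => replace (schwarzian_formula x z * mu z) with v; [exact P|] end.
  rewrite (E1 z Hz). unfold schwarzian_formula. field. now apply Hx0. }
intros z Hz. split; [now apply E2|].
apply is_C_derive_unique.
assert (D1 := is_cderive_C_derive mu z Hmu Hz). assert (D2 := is_cderive_C_derive x z Hx Hz).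
assert (P := is_cderive_plus _ _ _ _ _
  (is_cderive_mult _ _ _ _ _ (is_cderive_C_derive _ z Hmu1 Hz) D2)
  (is_cderive_mult _ _ _ _ _ D1 (is_cderive_C_derive _ z Hx1 Hz))).
apply (is_cderive_ext_disc _ (C_derive (fun y => mu y * x y))) in P; [|intros y Hy|assumption].
- simpl in P. match type of P with is_derive _ _ ?v => replace (schwarzian_formula x z * (mu z * x z)) with v; [exact P|] end.
  (* In (mu x)'' = mu'' x + 2 mu' x' + mu x'' the last two terms cancel by the formula for mu'. *)
  rewrite (E2 z Hz), (E1 z Hz). field. now apply Hx0.
- symmetry. apply is_C_derive_unique. apply is_cderive_mult; now apply is_cderive_C_derive.
Qed.

(** Both vectors span the same line, so [v] is a multiple of (1, a). This reduces an arbitrary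
    lifting to its first component. *)
Lemma homogeneous_coordinates_affine (p : CP1) (v : C2) (a : C) :
  homogeneous_coordinates p (RtoC 1, a) -> homogeneous_coordinates p v -> snd v = fst v * a.
Proof.
intros [_ H1] [_ H2].
assert (Hv : line p v).
{ apply H2. exists (RtoC 1). unfold C2_scal. apply injective_projections; simpl fst; simpl snd; ring. }
apply H1 in Hv. destruct Hv as [c ->]. unfold C2_scal; simpl fst; simpl snd. ring.
Qed.

Theorem mainTheorem4 :
  forall (x : C -> C) (Phi : C -> CP1),
    holomorphic_on unit_disc x ->
    (forall z : C, unit_disc z -> C_derive x z <> 0) ->
    (forall z : C, unit_disc z ->
       homogeneous_coordinates (Phi z) (RtoC 1, x z)) ->
    is_immersed_lifting Phi (fun z => (RtoC 1, x z)) /\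
    (forall kappa0 : C -> C,
       is_schwarzian_curvature Phi kappa0 <->
       (forall z : C, unit_disc z ->
          kappa0 z =
            3 / 4 * (C_derive (C_derive x) z / C_derive x z) ^ 2
            - 1 / 2 * (C_derive (C_derive (C_derive x)) z / C_derive x z))) /\
    (forall z : C, unit_disc z ->
       3 / 4 * (C_derive (C_derive x) z / C_derive x z) ^ 2
       - 1 / 2 * (C_derive (C_derive (C_derive x)) z / C_derive x z)
       = - (1 / 2) * schwarzian_derivative x z).
Proof.
intros x Phi Hx Hx0 HPhi.
assert (Hx1 := holomorphic_C_derive _ Hx). assert (Hx2 := holomorphic_C_derive _ Hx1).
assert (Hx3 := holomorphic_C_derive _ Hx2).
assert (D1 : forall z, C_derive (fun _ : C => RtoC 1) z = 0)
  by (intros z; apply is_C_derive_unique, is_cderive_const).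
assert (Lift : is_immersed_lifting Phi (fun z => (RtoC 1, x z))).
{ split; [split; [intros z Hz; exact (ex_cderive_const 1 z)|exact Hx]|].
  intros z Hz; split; [now apply HPhi|].
  unfold C2_lin_indep, C2_derive, C2_plus, C2_scal, C2_zero; simpl fst; simpl snd.
  intros a b E. change (fun t : C => x t) with x in E. rewrite D1 in E.
  assert (Ea := f_equal fst E). assert (Eb := f_equal snd E). simpl fst in Ea; simpl snd in Eb.
  assert (a = 0) by (rewrite <- Ea; ring). subst a. split; [reflexivity|].
  replace (0 * x z + b * C_derive x z) with (b * C_derive x z) in Eb by ring.
  destruct (Ceq_dec b 0) as [|Hb]; [assumption|].
  exfalso; revert Eb. apply Cmult_neq_0; [assumption|now apply Hx0]. }
split; [exact Lift|]. split; [|intros z Hz; unfold schwarzian_derivative; field; now apply Hx0].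
intros kappa0. change (is_schwarzian_curvature Phi kappa0 <->
  forall z, unit_disc z -> kappa0 z = schwarzian_formula x z).
split.
- intros (_ & f & lambda & [[Hf1 Hf2] Hf] & [Hl Hn] & Hnu) z Hz.
  (* The first component of the normalized curve nu. *)
  set (mu := fun y => lambda y * fst (f y)).
  assert (Hmu : holomorphic_on unit_disc mu)
    by (intros y Hy; apply ex_cderive_mult; [now apply Hl|now apply Hf1]).
  assert (Hs : forall y, unit_disc y -> snd (f y) = fst (f y) * x y).
  { intros y Hy. apply homogeneous_coordinates_affine with (Phi y); [now apply HPhi|now apply Hf]. }
  (* With f = f1 (1, x) on the disc the terms containing f1' cancel, and det[f, f'] = f1^2 x'. *)
  assert (Hmn : forall y, unit_disc y -> mu y * mu y * C_derive x y = 1).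
  { intros y Hy. destruct (Hn y Hy) as [_ <-].
    unfold C2_det, C2_derive, mu; simpl fst; simpl snd.
    rewrite (C_derive_ext_disc (fun t => snd (f t)) (fun t => fst (f t) * x t) y Hs Hy)
      by (apply ex_cderive_mult; [now apply Hf1|now apply Hx]).
    assert (P := is_C_derive_unique _ _ _ (is_cderive_mult _ _ _ _ _
      (is_cderive_C_derive _ y Hf1 Hy) (is_cderive_C_derive x y Hx Hy))).
    change (C_derive (fun t : C => fst (f t) * x t) y =
      C_derive (fun t : C => fst (f t)) y * x y + fst (f y) * C_derive x y) in P.
    rewrite P, (Hs y Hy). ring. }
  assert (E := f_equal fst (Hnu z Hz)).
  unfold C2_derive, C2_scal in E; simpl fst in E.
  destruct (schwarzian_equation x mu Hx Hx0 Hmu Hmn z Hz) as [E' _].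
  change (C_derive (C_derive mu) z = kappa0 z * mu z) in E. rewrite E' in E.
  assert (Hm0 : mu z <> 0).
  { intros E0. specialize (Hmn z Hz). rewrite E0 in Hmn.
    replace (0 * 0 * C_derive x z) with (RtoC 0) in Hmn by ring. apply RtoC_inj in Hmn. lra. }
  replace (kappa0 z) with (kappa0 z * mu z / mu z) by (field; assumption).
  rewrite <- E. field. assumption.
- intros Hk. split.
  + intros z Hz.
    (* The formula is itself holomorphic; its square is written as a product so that the product
       rule applies. *)
    destruct (ex_cderive_minus (fun y => 3 / 4 * ((C_derive (C_derive x) y / C_derive x y) * (C_derive (C_derive x) y / C_derive x y)))
      (fun y => 1 / 2 * (C_derive (C_derive (C_derive x)) y / C_derive x y)) z) as [l Hl'].
    * apply ex_cderive_mult; [apply ex_cderive_const|].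
      apply ex_cderive_mult; apply ex_cderive_div; auto.
    * apply ex_cderive_mult; [apply ex_cderive_const|]. apply ex_cderive_div; auto.
    * exists l. eapply is_cderive_ext_disc; [|exact Hz|exact Hl'].
      intros y Hy. rewrite (Hk y Hy). unfold schwarzian_formula. field. now apply Hx0.
  + destruct (holomorphic_inv_sqrt _ Hx1 Hx0) as (mu & Hmu & Hn).
    exists (fun z => (RtoC 1, x z)), mu. split; [exact Lift|]. split; [split; [exact Hmu|]|].
    * intros z Hz; split.
      -- intros E0. specialize (Hn z Hz). rewrite E0 in Hn.
         replace (0 * 0 * C_derive x z) with (RtoC 0) in Hn by ring. apply RtoC_inj in Hn. lra.
      -- unfold C2_det, C2_derive; simpl fst; simpl snd. rewrite D1.
         change (fun t : C => x t) with x.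
         transitivity (mu z * mu z * C_derive x z); [ring|now apply Hn].
    * intros nu z Hz. rewrite (Hk z Hz).
      destruct (schwarzian_equation x mu Hx Hx0 Hmu Hn z Hz) as [E1 E2].
      unfold nu, C2_derive, C2_scal; simpl fst; simpl snd.
      apply injective_projections; simpl fst; simpl snd; [|exact E2].
      (* The first component of nu is mu times 1, which is replaced by mu under both derivatives. *)
      replace (mu z * 1) with (mu z) by ring. rewrite <- E1.
      apply C_derive_ext_disc; [|assumption|now apply holomorphic_C_derive].
      intros y Hy. apply C_derive_ext_disc; [|assumption|now apply Hmu].
      intros u Hu. ring.
Qed.
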